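(* Let $C\subset\mathbb{R}^n$ be a polyhedral set, let $\Lambda_C$ be a complementarity relation on $C$, and let $\Phi_C:\mathbb{R}^n\rightrightarrows\mathbb{R}^n$ be the complementarity mapping $\Phi_C(x)=x+\Lambda_C(F^C_{\min}(x))$ for $x\in C$, $\Phi_C(x)=\emptyset$ for $x\notin C$. If $\Phi_C$ is (globally metrically) regular, then the inverse mapping $\Phi_C^{-1}$ is single-valued and Lipschitz on $\mathbb{R}^n$. Thus regularity of $\Phi_C$ implies global strong regularity of $\Phi_C$.
   Context: A polyhedral set in $\mathbb{R}^n$ is a nonempty intersection of finitely many closed half-spaces; it is a polyhedral cone if the half-spaces are of the form $\{x:\langle y_i,x\rangle\le 0\}$. A face of a polyhedral set $C$ is a nonempty closed convex subset $F\subset C$ such that whenever $[a,b]\subset C$ is a segment and some point of the relative interior of $[a,b]$ belongs to $F$, then $[a,b]\subset F$ ($C$ itself is a face). $\mathcal{F}_C$ is the (finite) collection of all faces of $C$; $\mathcal{F}_C(\bar F)=\{F\in\mathcal{F}_C:\bar F\subset F\}$; $F^C_{\min}(x)$ is the smallest face of $C$ containing $x\in C$. $L(Q)$ is the linear subspace spanned by $Q-Q$. $\mathrm{cone}\,Q$ is the convex cone generated by $Q$. For a face $\bar F$, $T(C,\bar F)$ is the common tangent cone to $C$ at the points of $\mathrm{ri}\,\bar F$; it equals $\mathrm{cone}(C-\bar F)$, and its faces are exactly the sets $\mathrm{cone}(F-\bar F)$, $F\in\mathcal{F}_C(\bar F)$. Two polyhedral cones $K,H\subset\mathbb{R}^n$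 are face complementary if there is a bijection $\Lambda:\mathcal{F}_K\to\mathcal{F}_H$ (a complementarity correspondence) such that for all $F,F'\in\mathcal{F}_K$: (i) $\dim L(F)+\dim L(\Lambda(F))=n$; (ii) $F\subset F'$ implies $\Lambda(F')\subset\Lambda(F)$. A complementarity relation on a polyhedral set $C$ is a map $\Lambda_C$ assigning to each $\bar F\in\mathcal{F}_C$ a set $\Lambda_C(\bar F)\subset\mathbb{R}^n$ such that for every $\bar F\in\mathcal{F}_C$: (i) $\Lambda_C(\bar F)$ is a polyhedral cone; (ii) $T(C,\bar F)$ and $\Lambda_C(\bar F)$ are face complementary cones, with complementarity correspondence given by $\mathrm{cone}(F-\bar F)\leftrightarrow\Lambda_C(F)$, $F\in\mathcal{F}_C(\bar F)$. A set-valued mapping $\Phi:\mathbb{R}^n\rightrightarrows\mathbb{R}^n$ is (globally metrically) regular if there is $\kappa>0$ with $d(x,\Phi^{-1}(z))\le\kappa\, d(z,\Phi(x))$ for all $(x,z)\in\mathbb{R}^n\times\mathbb{R}^n$ (with $d(\cdot,\emptyset)=\infty$). It is globally strongly regular if it is globally regular and $\Phi(x)\cap\Phi(u)=\emptyset$ whenever $x\ne u$. *)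

(* Defs.v *)
From HB Require Import structures.
From mathcomp Require Import all_boot all_order all_algebra.
From mathcomp Require Import all_classical all_reals all_analysis.

Set Implicit Arguments.
Unset Strict Implicit.
Unset Printing Implicit Defensive.

Import Order.TTheory GRing.Theory Num.Theory.
Import numFieldNormedType.Exports.

Local Open Scope classical_set_scope.
Local Open Scope ring_scope.

Section EuclideanSpace.
Context {R : realType} {n : nat}.
Local Notation E := 'rV[R]_n.
Implicit Types (x y z u : E) (Q K H : set E).

Definition dot x y : R := \sum_(i < n) x 0 i * y 0 i.

(* The norm that the library puts on row vectors is the sup norm. *)
Definition enorm x : R := Num.sqrt (dot x x).

(* The infimum of the empty set is +oo. *)
Definition dist x Q : \bar R := ereal_inf [set (enorm (x - y))%:E | y in Q].

Definition segment x y : set E :=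
  [set (1 - t) *: x + t *: y | t in `[0%R, 1%R]%classic].

Definition set_sub Q H : set E := [set x - y | x in Q & y in H].

(* The linear span L(Q) of Q - Q, as the least subspace containing Q - Q. It
   always exists, so that the default value 0 is never taken: see dirspaceP. *)
Definition dirspace Q : {vspace E} :=
  xget 0%VS [set U : {vspace E} | (forall v, set_sub Q Q v -> v \in U) /\
    (forall W : {vspace E}, (forall v, set_sub Q Q v -> v \in W) -> (U <= W)%VS)].

Lemma dirspaceP Q :
  (forall v, set_sub Q Q v -> v \in dirspace Q) /\
  forall W : {vspace E}, (forall v, set_sub Q Q v -> v \in W) ->
    (dirspace Q <= W)%VS.
Proof.
rewrite /dirspace; case: xgetP => [U -> []//|no]; exfalso.
have [k] := ubnP (\dim (fullv : {vspace E})).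
have : forall v, set_sub Q Q v -> v \in (fullv : {vspace E}) by move=> v _; rewrite memvf.
move: (fullv) => U; elim: k U => // k IH U QU dU.
apply: (no U); split=> // W QW; apply: contrapT => /negP nUW.
apply: (IH (U :&: W)%VS) => [v Qv|]; first by rewrite memv_cap QU ?QW.
rewrite ltnS in dU; apply: leq_trans dU.
rewrite ltn_neqAle dimvS ?capvSl// andbT; apply: contra nUW => h.
by apply/capv_idPl/eqP; rewrite -(geq_leqif (dimv_leqif_eq (capvSl U W))) (eqP h).
Qed.

(* The affine hull of Q is x + dirspace Q for every x in Q. *)
Definition ri Q : set E :=
  [set x | Q x /\ \forall y \near x, y - x \in dirspace Q -> Q y].

Definition convex_cone K : Prop :=
  [/\ K 0, convex_set (K : set (convex_lmodType E)) & forall (t : R) x, 0 <= t -> K x -> K (t *: x)].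

Definition cone Q : set E := smallest convex_cone Q.

Definition polyhedral_set Q : Prop :=
  Q !=set0 /\ exists m (y : 'I_m -> E) (b : 'I_m -> R),
    (forall i, y i != 0) /\ Q = [set x | forall i, dot (y i) x <= b i].

Definition polyhedral_cone K : Prop :=
  exists m (y : 'I_m -> E),
    (forall i, y i != 0) /\ K = [set x | forall i, dot (y i) x <= 0].

Definition faces Q : set (set E) :=
  [set F | [/\ F !=set0, closed F, convex_set (F : set (convex_lmodType E)),
    F `<=` Q &
    forall a b, segment a b `<=` Q -> ri (segment a b) `&` F !=set0 ->
      segment a b `<=` F]].

Definition min_face Q x : set E := smallest (faces Q) [set x].

Definition tangent_cone Q x : set E :=
  [set h | exists (t : nat -> R) (v : nat -> E),
    [/\ forall k, 0 < t k, t @ \oo --> 0, v @ \oo --> h &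
        forall k, Q (x + t k *: v k)]].

(* For a face F of a polyhedral set Q, the sets tangent_cone Q x with x in ri F
   all coincide, and ri F is nonempty: the intersection is their common value. *)
Definition face_tangent_cone Q F : set E :=
  \bigcap_(x in ri F) tangent_cone Q x.

Definition face_complementary_by (M : set E -> set E) K H : Prop :=
  [/\ polyhedral_cone K, polyhedral_cone H,
    set_bij (faces K) (faces H) M,
    forall F, faces K F -> (\dim (dirspace F) + \dim (dirspace (M F)) = n)%N &
    forall F F', faces K F -> faces K F' -> F `<=` F' -> M F' `<=` M F].

(* Only the values of Lam at the faces of Q matter. *)
Definition complementarity_relation Q (Lam : set E -> set E) : Prop :=
  forall F0, faces Q F0 ->
    polyhedral_cone (Lam F0) /\
    exists M : set E -> set E,
      face_complementary_by M (face_tangent_cone Q F0) (Lam F0) /\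
      forall F, faces Q F -> F0 `<=` F -> M (cone (set_sub F F0)) = Lam F.

Definition complementarity_mapping Q (Lam : set E -> set E) : E -> set E :=
  fun x => if x \in Q then [set x + v | v in Lam (min_face Q x)] else set0.

Definition inverse_mapping (Phi : E -> set E) : E -> set E :=
  fun z => [set x | Phi x z].

Definition globally_regular (Phi : E -> set E) : Prop :=
  exists2 kappa : R, 0 < kappa &
    forall x z,
      (dist x (inverse_mapping Phi z) <= kappa%:E * dist z (Phi x))%E.

Definition globally_strongly_regular (Phi : E -> set E) : Prop :=
  globally_regular Phi /\ forall x u, x != u -> Phi x `&` Phi u = set0.

Definition single_valued_lipschitz (Psi : E -> set E) : Prop :=
  exists g : E -> E, (forall z, Psi z = [set g z]) /\
    exists2 l : R, 0 <= l & forall z u, enorm (g z - g u) <= l * enorm (z - u).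

End EuclideanSpace.

(* Main.v *)
Require Import Defs.
From HB Require Import structures.
From mathcomp Require Import all_boot all_order all_algebra.
From mathcomp Require Import all_classical all_reals all_analysis.
From mathcomp Require Import ring lra.

(** The graph of the complementarity mapping of [C] is the image of the union [G]
    of the cells [F * Lam F], over the faces [F] of [C], under the map
    [(x, v) |-> (x, x + v)]. Its inverse is single-valued exactly when the sum
    map [(x, v) |-> x + v] is injective and onto on [G]; regularity makes the sum
    map onto and open, and once the inverse is single-valued the regularity
    estimate is its Lipschitz estimate. So everything rests on injectivity
    ([graph_injective]).

    Complementarity enters only through order and dimension: above a given face
    [F] the map [Lam] is an order-reversing bijection onto the faces of [Lam F],
    with complementary dimensions ([compl_face], [compl_surj], [compl_inj],
    [compl_anti], [compl_dim]). With openness this makes the linear spans of [F]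
    and [Lam F] complementary ([dirspaces_cap]), so the sum map is injective on
    each cell.

    Injectivity is first proved near each point [p = (x0, v0)] of [G], where [G]
    is a translate of a cone, by induction on the number of cells at [p]. Those
    are the cells of the faces between a smallest one [F] and a largest one [F'];
    let [K] be the tangent cone of [F'] at [x0] and [H] that of [Lam F] at [v0].
    If there are no other cells, openness puts [K] and [H] on opposite sides of
    their common boundary. Otherwise two ideas are combined. The first shows that
    points of [K] have a single preimage: if [(a, h)] is a preimage of [a + h] in
    [K], then [a + s h] is in [K] for [0 <= s <= 1], so [(a, s h)] and
    [(a + s h, 0)] are two preimages of the same point, arbitrarily close to
    [(a, 0)], where injectivity holds by induction unless [a] is lineal
    ([preimage_in_K], [KH_trivial], [preimage_unique]). The second is that a
    pair of distinct preimages can be followed along any segment over which the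
    sum map is locally injective: openness continues the pair, and local
    injectivity keeps it distinct in the limit ([lift_two_preimages]). A pair
    can thus be carried to a point of [K], along a segment that avoids the sums
    of lineal directions, which is absurd ([cone_injective_between]).

    The same two ideas give global injectivity with [C] in the place of [K]:
    points of [C] have a single preimage ([graph_over_C]), and a pair of distinct
    preimages could be carried along a segment to a point of [C]. *)

Set Implicit Arguments.
Unset Strict Implicit.
Unset Printing Implicit Defensive.

Import Order.TTheory GRing.Theory Num.Theory.
Import numFieldNormedType.Exports.

Local Open Scope classical_set_scope.
Local Open Scope ring_scope.

Ltac vec := apply/rowP => ?; rewrite ?(mxE, mulr1n); ring.
Ltac vfield := apply/rowP => ?; rewrite ?mxE; field.

(** * Convex sets, extreme subsets and feasible directions *)

(* Membership in a set is transported along an identity between points. *)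
Ltac at_point H tac :=
  match type of H with _ ?y => match goal with |- _ ?x =>
    (suff -> : x = y by exact: H); tac end end.

Section Convexity.
Context {R : realType} {n : nat}.
Local Notation E := 'rV[R]_n.
Implicit Types (a b x y z h u v : E) (P Q F : set E) (s t : R).

Definition convex P : Prop :=
  forall a b t, 0 <= t <= 1 -> P a -> P b -> P ((1 - t) *: a + t *: b).

Lemma convexE P : convex_set (P : set (convex_lmodType E)) <-> convex P.
Proof.
split=> [cP a b t /andP[t0 t1] Pa Pb|cP a b t].
  have := cP b a (Itv01 t0 t1); rewrite !inE => /(_ Pb Pa).
  by rewrite addrC.
rewrite !inE => Pa Pb.
have := cP b a t%:num; rewrite addrC; apply => //.
by rewrite ge0 le1.
Qed.

Lemma in_segment a b t : 0 <= t <= 1 -> segment a b ((1 - t) *: a + t *: b).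
Proof. by move=> t01; exists t. Qed.

Lemma segment_sub P a b : convex P -> P a -> P b -> segment a b `<=` P.
Proof. by move=> cP Pa Pb _ [t t01 <-]; apply: cP. Qed.

Lemma segment_ends a b : segment a b a /\ segment a b b.
Proof.
by split; [exists 0|exists 1]; rewrite /= ?in_itv/= ?lexx ?ler01//; vec.
Qed.

Lemma ri_segment a b x :
  ri (segment a b) x <-> exists2 t, 0 < t < 1 & x = (1 - t) *: a + t *: b.
Proof.
have [sa sb] := segment_ends a b.
have [dab dmin] := dirspaceP (segment a b).
have ab_dir : b - a \in dirspace (segment a b) by apply: dab; exists b => //; exists a.
case: (eqVneq a b) sa sb dab dmin ab_dir => [<-|neq] sa sb dab dmin ab_dir.
  have seg_aa y : segment a a y -> y = a by move=> [t _ <-]; vec.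
  split=> [[/seg_aa -> _]|[t _ ->]]; first by exists 2^-1; [lra|vec].
  have -> : (1 - t) *: a + t *: a = a by vec.
  split; first by case: (segment_ends a a).
  near=> y => ya; suff -> : y = a by case: (segment_ends a a).
  have : y - a \in (0%VS : {vspace E}).
    apply: (subvP (dmin 0%VS _)); last exact: ya.
    by move=> _ [u /seg_aa -> [v /seg_aa -> <-]]; rewrite subrr mem0v.
  by rewrite memv0 subr_eq0 => /eqP.
have nz : 0 < `|b - a| by rewrite normr_gt0 subr_eq0 eq_sym.
split=> [[[t /= t01 <-{x}]] /nbhs_ballP[e e0 be]|[t /andP[t0 t1] ->]].
  have [s s0 sE] : exists2 s : R, 0 < s & s * `|b - a| < e.
    exists (e / 2 / `|b - a|); first by rewrite !divr_gt0.
    by rewrite divfK ?gt_eqF//; have : 0 < e := e0; lra.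
  have step r : `|r| = s -> 0 <= t + r <= 1.
    move=> rs; have : segment a b ((1 - t) *: a + t *: b + r *: (b - a)).
      apply: be; last by rewrite [X in X \in _]addrC addKr memvZ.
      by rewrite -ball_normE/= opprD addrA subrr add0r normrN normrZ rs.
    move=> [t' t'01] /eqP; rewrite -subr_eq0.
    have -> : (1 - t') *: a + t' *: b - ((1 - t) *: a + t *: b + r *: (b - a)) =
      (t' - (t + r)) *: (b - a) by vec.
    by rewrite scaler_eq0 (subr_eq0 b) (eq_sym b) (negbTE neq) orbF subr_eq0 => /eqP <-.
  exists t => //; have := step s; have := step (- s); rewrite normrN gtr0_norm//.
  by move=> /(_ erefl) ? /(_ erefl) ?; lra.
split; first by apply: in_segment; lra.
have m0 : 0 < Num.min t (1 - t) by rewrite lt_min; lra.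
have : 0 < Num.min t (1 - t) * `|b - a| by exact: mulr_gt0.
move=> e0; apply/nbhs_ballP; exists (Num.min t (1 - t) * `|b - a|) => // y.
rewrite -ball_normE/= => ye ydir.
have : y - ((1 - t) *: a + t *: b) \in <[b - a]>%VS.
  apply: (subvP (dmin _ _)); last exact: ydir.
  move=> _ [u [p _ <-] [v [q _ <-] <-]].
  by apply/vlineP; exists (p - q); vec.
move=> /vlineP[c yc].
have {}ye : `|c| < Num.min t (1 - t).
  by rewrite -(ltr_pM2r nz) -normrZ -yc -normrN opprB.
have -> : y = (1 - (t + c)) *: a + (t + c) *: b.
  by rewrite -(subrK ((1 - t) *: a + t *: b) y) yc; vec.
by move: ye; rewrite lt_min !ltr_norml => ?; apply: in_segment; lra.
Unshelve. all: by end_near.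
Qed.

(** The segment condition in the definition of a face, for convex [P] and [F]:
    the relative interior of a segment is the open segment, and [F] contains a
    segment as soon as it contains both endpoints. *)
Definition extreme P F : Prop :=
  forall a b t, 0 < t < 1 -> P a -> P b -> F ((1 - t) *: a + t *: b) -> F a /\ F b.

Lemma facesE P F : convex P ->
  faces P F <-> [/\ F !=set0, closed F, convex F, F `<=` P & extreme P F].
Proof.
move=> cP; split=> [[F0 Fc /convexE cF FP ext]|[F0 Fc cF FP ext]].
  split=> // a b t t01 Pa Pb Fx.
  have [sa sb] := segment_ends a b.
  have FS : segment a b `<=` F.
    apply: ext; first exact: segment_sub.
    by exists ((1 - t) *: a + t *: b); split=> //; apply/ri_segment; exists t.
  by split; apply: FS.
split=> //; first exact/convexE.
move=> a b SP [x [/ri_segment[t t01 ->] Fx]].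
have [sa sb] := segment_ends a b.
have [Fa Fb] := ext _ _ _ t01 (SP _ sa) (SP _ sb) Fx.
exact: segment_sub.
Qed.

(** Feasible directions. For convex [P] and [x] in [P] this is the tangent cone
    before closure, and for polyhedra it is already closed. *)
Definition fd P x : set E := [set h | exists2 s, 0 < s & P (x + s *: h)].

Lemma fd_step P x h r s : convex P -> P x -> P (x + r *: h) -> 0 <= s <= r ->
  P (x + s *: h).
Proof.
move=> cP Px Pr /andP[s0 sr]; have [r0|r0] := leP r 0.
  have -> : s = 0 by lra.
  by rewrite scale0r addr0.
have -> : x + s *: h = (1 - s / r) *: x + (s / r) *: (x + r *: h).
  by vfield; rewrite gt_eqF.
by apply: cP => //; rewrite divr_ge0 ?(ltW r0)// ler_pdivrMr// mul1r.
Qed.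

Lemma fd_near P x h : convex P -> P x -> fd P x h ->
  \forall s \near 0^'+, P (x + s *: h).
Proof.
move=> cP Px [r r0 Pr]; near=> s.
apply: (fd_step cP Px Pr); apply/andP; split; near: s; first exact: nbhs_right_ge.
exact: nbhs_right_le.
Unshelve. all: by end_near.
Qed.

Lemma near0_ex (Q : R -> Prop) : (\forall s \near 0^'+, Q s) -> exists2 s : R, 0 < s & Q s.
Proof.
move=> nQ; have : \forall s \near (0 : R)^'+, 0 < s /\ Q s.
  by near=> s; split; near: s => //; exact: nbhs_right_gt.
by move=> /filter_ex[s [s0 Qs]]; exists s.
Unshelve. all: by end_near.
Qed.

Lemma fd0 P x : P x -> fd P x 0.
Proof. by move=> Px; exists 1 => //; rewrite scaler0 addr0. Qed.

Lemma fdZ P x h r : P x -> 0 <= r -> fd P x h -> fd P x (r *: h).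
Proof.
move=> Px r0 [s s0 Ps]; have [->|rn0] := eqVneq r 0; first by rewrite scale0r; exact: fd0.
have {r0 rn0} r0 : 0 < r by rewrite lt_neqAle eq_sym rn0.
by exists (s / r); rewrite ?divr_gt0// scalerA divfK// gt_eqF.
Qed.

Lemma fdZE P x h r : P x -> 0 < r -> fd P x (r *: h) -> fd P x h.
Proof.
move=> Px r0 /(fdZ Px (ltW (_ : 0 < r^-1))).
by rewrite invr_gt0 scalerA mulVf ?gt_eqF// scale1r; apply.
Qed.

Lemma fdD P x h k : convex P -> P x -> fd P x h -> fd P x k -> fd P x (h + k).
Proof.
move=> cP Px /(fd_near cP Px) nh /(fd_near cP Px) nk.
have [s s0 [Ph Pk]] := near0_ex (filterI nh nk).
exists (s / 2); first by rewrite divr_gt0.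
have -> : x + (s / 2) *: (h + k) = (1 - 2^-1) *: (x + s *: h) + 2^-1 *: (x + s *: k).
  by vfield.
by apply: cP => //; lra.
Qed.

Lemma fd_sub P Q x : P `<=` Q -> fd P x `<=` fd Q x.
Proof. by move=> PQ h [s s0 Ph]; exists s => //; apply: PQ. Qed.

Lemma fd_mem P x y : P y -> fd P x (y - x).
Proof. by move=> Py; exists 1 => //; rewrite scale1r addrC subrK. Qed.

Lemma fd_dirspace P x h : P x -> fd P x h -> h \in dirspace P.
Proof.
move=> Px [s s0 Ps]; have [dP _] := dirspaceP P.
have : s *: h \in dirspace P.
  by apply: dP; exists (x + s *: h) => //; exists x => //; rewrite addrC addKr.
by move=> /(memvZ s^-1); rewrite scalerA mulVf ?gt_eqF// scale1r.
Qed.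

(** The relative interior of a convex set. This pointwise form, with no
    neighbourhood, is what the arguments about faces use. *)
Definition relint P : set E := [set x | P x /\ forall h, h \in dirspace P -> fd P x h].

(** A segment of [Q] that ends at a given point of [Q] extends beyond [x], so an
    extreme subset that contains [x] contains that point. *)
Lemma relint_min P F x : convex F -> extreme P F -> forall Q, Q `<=` P ->
  relint Q x -> F x -> Q `<=` F.
Proof.
move=> cF eF Q QP [Qx dQ] Fx y Qy.
have [s s0 Qs] : fd Q x (x - y).
  by apply: dQ; apply: (dirspaceP Q).1; exists x => //; exists y.
have i01 : 0 < (1 + s)^-1 < 1 by rewrite invr_gt0 invf_lt1 ?ltrDl ?addr_gt0 ?s0.
have [] // := eF y (x + s *: (x - y)) _ i01 (QP _ Qy) (QP _ Qs).
suff -> : (1 - (1 + s)^-1) *: y + (1 + s)^-1 *: (x + s *: (x - y)) = x by [].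
by vfield; rewrite gt_eqF// addr_gt0.
Qed.

(** The point [x] lies strictly between [y] and a point of [F], and the homothety
    centred at the latter carries a step out of [y] to a step out of [x]. *)
Lemma fd_relint P F x y : convex P -> F `<=` P -> relint F x -> F y -> fd P y `<=` fd P x.
Proof.
move=> cP FP [Fx dF] Fy h [s s0 Ph].
have [r r0 Fr] : fd F x (x - y).
  by apply: dF; apply: (dirspaceP F).1; exists x => //; exists y.
exists (r * s / (1 + r)); first by rewrite divr_gt0 ?mulr_gt0 ?addr_gt0.
have -> : x + (r * s / (1 + r)) *: h =
    (1 - r / (1 + r)) *: (x + r *: (x - y)) + (r / (1 + r)) *: (y + s *: h).
  by vfield; rewrite gt_eqF// addr_gt0.
apply: cP => //; last exact: FP.
by rewrite divr_ge0 ?addr_ge0 ?(ltW r0)//= ler_pdivrMr ?addr_gt0// mul1r lerDr.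
Qed.

End Convexity.

(** * Polyhedra *)

Section DotProduct.
Context {R : realType} {n : nat}.
Local Notation E := 'rV[R]_n.
Implicit Types (a b c x y z h u v : E) (P Q F : set E) (s t : R).

Lemma dotD c x y : dot c (x + y) = dot c x + dot c y.
Proof. by rewrite -big_split; apply: eq_bigr => i _; rewrite mxE mulrDr. Qed.

Lemma dotZ c s x : dot c (s *: x) = s * dot c x.
Proof. by rewrite mulr_sumr; apply: eq_bigr => i _; rewrite mxE mulrCA. Qed.

Lemma dotB c x y : dot c (x - y) = dot c x - dot c y.
Proof. by rewrite -scaleN1r dotD dotZ mulN1r. Qed.

Definition dotl c : E -> R^o := dot c.

Lemma dotl_is_linear c : linear (dotl c).
Proof. by move=> s x y; rewrite /dotl dotD dotZ. Qed.

HB.instance Definition _ c := GRing.isLinear.Build R E R^o _ (dotl c) (dotl_is_linear c).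

Lemma dot_lker c x : (x \in lker (linfun (dotl c))) = (dot c x == 0).
Proof. by rewrite memv_ker lfunE. Qed.

Lemma le_coord x i : `|x 0 i| <= `|x|.
Proof.
by rewrite [leRHS]mx_normrE; exact: (le_bigmax _ (fun ij => `|x ij.1 ij.2|) (0, i)).
Qed.

Lemma dot_bound c x : `|dot c x| <= (\sum_i `|c 0 i|) * `|x|.
Proof.
rewrite mulr_suml; apply: (le_trans (ler_norm_sum _ _ _)); apply: ler_sum => i _.
by rewrite normrM ler_wpM2l// le_coord.
Qed.

Lemma dot_continuous c : continuous (dot c).
Proof.
move=> x; apply/(@cvgrPdist_lt R R^o E (nbhs x) _) => e e0.
have M0 : 0 < \sum_i `|c 0 i| + 1 by rewrite ltr_wpDl// sumr_ge0.
apply/nbhs_ballP; exists (e / (\sum_i `|c 0 i| + 1)); first by rewrite /= divr_gt0.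
move=> y; rewrite -ball_normE/= ltr_pdivlMr// mulrC => xy.
rewrite -dotB; apply: (le_lt_trans (dot_bound _ _)); apply: le_lt_trans xy.
by rewrite ler_wpM2r// lerDl.
Qed.

Lemma near_scale_lt (c e : R) : 0 < e -> \forall s \near (0 : R)^'+, s * c < e.
Proof.
move=> e0; have c0 : 0 < `|c| + 1 by rewrite ltr_wpDl.
near=> s; have s0 : 0 < s by near: s; exact: nbhs_right_gt.
have : s < e / (`|c| + 1) by near: s; apply: nbhs_right_lt; rewrite divr_gt0.
rewrite ltr_pdivlMr//; apply: le_lt_trans; rewrite ler_wpM2l ?(ltW s0)//.
by have := ler_norm c; lra.
Unshelve. all: by end_near.
Qed.

Lemma near_scale h e : 0 < e -> \forall s \near (0 : R)^'+, `|s *: h| < e.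
Proof.
move=> e0; near=> s; rewrite normrZ gtr0_norm; last by near: s; exact: nbhs_right_gt.
by near: s; exact: near_scale_lt.
Unshelve. all: by end_near.
Qed.

(** At a point of a polyhedron all small feasible directions are feasible with
    step one, uniformly in the direction. *)
Definition locally_conical P x : Prop :=
  \forall e \near 0^'+, forall h, `|h| < e -> fd P x h -> P (x + h).

(** A limit direction, once scaled to be small, is a limit of small directions,
    which are feasible with step one. *)
Lemma closed_fd P x : closed P -> P x -> locally_conical P x -> closed (fd P x).
Proof.
move=> Pc Px /near0_ex[e e0 Pe] h hcl.
have /near0_ex[s s0 sh] := near_scale h (divr_gt0 e0 (ltr0n R 2)).
apply: (fdZE Px s0); exists 1 => //; rewrite scale1r; apply: Pc => B /nbhs_ballP[d d0 dB].
have r0 : 0 < Num.min (e / 2) d / s by rewrite divr_gt0// lt_min divr_gt0.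
have [k [fk]] := hcl _ (nbhsx_ballx h _ r0).
rewrite -ball_normE/= => hk.
have /andP[k1 k2] : (`|s *: h - s *: k| < e / 2) && (`|s *: h - s *: k| < d).
  by rewrite -lt_min -scalerBr normrZ gtr0_norm// mulrC -ltr_pdivlMr.
exists (x + s *: k); split; last by apply: dB; rewrite -ball_normE/= opprD addrACA subrr add0r.
apply: Pe; last by apply: fdZ => //; exact: ltW.
rewrite -(subrK (s *: h) (s *: k)); apply: (le_lt_trans (ler_normD _ _)).
by rewrite distrC; lra.
Qed.

(** A small direction that is feasible for [F] leads with step one to a point of
    [P], and some shorter step is in [F]: extremality gives the endpoint. *)
Lemma face_locally_conical P F x : convex P -> F `<=` P -> extreme P F -> convex F ->
  F x -> locally_conical P x -> locally_conical F x.
Proof.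
move=> cP FP eF cF Fx; apply: filterS => e Pe h he Fh.
have Ph := Pe h he (fd_sub FP Fh).
have [s [s0 s1 Fs]] : exists s, [/\ 0 < s, s < 1 & F (x + s *: h)].
  have : \forall s \near (0 : R)^'+, s < 1 /\ F (x + s *: h).
    near=> s; split; near: s; first exact: nbhs_right_lt.
    exact: fd_near.
  by move=> /near0_ex[s s0 [s1 Fs]]; exists s.
have [||//] := eF x (x + h) s _ (FP _ Fx) Ph; first by rewrite s0.
by have -> : (1 - s) *: x + s *: (x + h) = x + s *: h by vec.
Unshelve. all: by end_near.
Qed.

End DotProduct.

Section Polyhedra.
Context {R : realType} {n : nat}.
Local Notation E := 'rV[R]_n.
Implicit Types (x z h u v : E) (Q F : set E) (s t : R).

Section Constraints.
Variables (m : nat) (y : 'I_m -> E) (b : 'I_m -> R).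
Let P : set E := [set x | forall i, dot (y i) x <= b i].

Lemma cons_convex : convex P.
Proof.
move=> x z t /andP[t0 t1] Px Pz i; rewrite dotD !dotZ.
have := Px i; have := Pz i; nra.
Qed.

Lemma cons_closed : closed P.
Proof.
have -> : P = \bigcap_i (dot (y i) @^-1` [set r | r <= b i]).
  by by apply/seteqP; split=> x h i => [_|]; [exact: h|exact: (h i I)].
apply: closed_bigI => i _; apply: preimage_closed; last exact: closed_le.
by move=> x _; exact: dot_continuous.
Qed.

Definition active x : {set 'I_m} := [set i | dot (y i) x == b i].

Lemma fd_cons x h : P x -> fd P x h <-> forall i, i \in active x -> dot (y i) h <= 0.
Proof.
move=> Px; split=> [[s s0 Ps] i|ah].
  rewrite inE => /eqP ai; have := Ps i.
  by rewrite dotD dotZ ai gerDl pmulr_rle0.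
suff /near0_ex[s s0 Ps] : \forall s \near 0^'+, P (x + s *: h) by exists s.
suff : \forall s \near 0^'+, forall i, dot (y i) (x + s *: h) <= b i by [].
apply: filter_forall => i; have := ah i; rewrite inE; have := Px i.
rewrite le_eqVlt => /orP[/eqP bi /(_ (introT eqP bi)) hi|bi _].
  near=> s; have s0 : 0 < s by near: s; exact: nbhs_right_gt.
  by rewrite dotD dotZ bi gerDl pmulr_rle0.
have M0 : 0 < `|dot (y i) h| + 1 by rewrite ltr_wpDl.
near=> s; have s0 : 0 < s by near: s; exact: nbhs_right_gt.
have : s < (b i - dot (y i) x) / (`|dot (y i) h| + 1).
  by near: s; apply: nbhs_right_lt; rewrite divr_gt0// subr_gt0.
rewrite ltr_pdivlMr// dotD dotZ; have := ler_norm (dot (y i) h); nra.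
Unshelve. all: by end_near.
Qed.

Lemma cons_locally_conical x : P x -> locally_conical P x.
Proof.
move=> Px; near=> e => h he /(fd_cons _ Px) ah; move: h he ah.
suff : forall i h, `|h| < e -> (i \in active x -> dot (y i) h <= 0) ->
    dot (y i) (x + h) <= b i.
  by move=> sh h he ah i; apply: sh => //; exact: ah.
near: e; apply: filter_forall => i; have := Px i.
rewrite le_eqVlt => /orP[/eqP bi|bi].
  near=> e => h he; rewrite inE bi eqxx => /(_ isT) hi.
  by rewrite dotD bi gerDl.
have M0 : 0 < \sum_j `|y i 0 j| + 1 by rewrite ltr_wpDl// sumr_ge0.
near=> e => h he _; rewrite dotD.
have : e < (b i - dot (y i) x) / (\sum_j `|y i 0 j| + 1).
  by near: e; apply: nbhs_right_lt; rewrite divr_gt0// subr_gt0.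
have := dot_bound (y i) h; have := ler_norm (dot (y i) h).
have : 0 <= \sum_j `|y i 0 j| by rewrite sumr_ge0.
have := normr_ge0 h.
move: (\sum_j _) (`|h|) (`|dot _ _|) he => S H D he H0 S0 d1 d2.
rewrite ltr_pdivlMr; last lra.
move=> ?; nra.
Unshelve. all: by end_near.
Qed.

Definition subface (I : {set 'I_m}) : set E :=
  [set x | P x /\ forall i, i \in I -> dot (y i) x = b i].

Lemma subface_face I : subface I !=set0 -> faces P (subface I).
Proof.
move=> I0; apply/(facesE _ cons_convex); split => //.
- have -> : subface I = P `&` \bigcap_(i in [set` I]) (dot (y i) @^-1` [set b i]).
    by apply/seteqP; split=> x [Px h]; split.
  apply: closedI; first exact: cons_closed.
  apply: closed_bigI => i _; apply: preimage_closed; last exact: closed_eq.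
  by move=> x _; exact: dot_continuous.
- move=> u v t t01 [Pu Iu] [Pv Iv]; split; first exact: cons_convex.
  by move=> i iI; rewrite dotD !dotZ Iu// Iv//; ring.
- by move=> x [].
- move=> u v t t01 Pu Pv [_ It]; split; split=> // i iI; have := It i iI;
    rewrite dotD !dotZ; have := Pu i; have := Pv i; nra.
Qed.

Lemma dirspace_subface (I : {set 'I_m}) h i : i \in I ->
  h \in dirspace (subface I) -> dot (y i) h = 0.
Proof.
move=> iI; have [_ dmin] := dirspaceP (subface I).
have /subvP sub : (dirspace (subface I) <= lker (linfun (dotl (y i))))%VS.
  apply: dmin => _ [u [_ Iu] [v [_ Iv] <-]].
  by rewrite dot_lker dotB Iu// Iv// subrr.
by move=> /sub; rewrite dot_lker => /eqP.
Qed.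

(** Near [x] only the constraints active at [x] matter, and on the subspace that
    they cut out they stay active. *)
Lemma relint_subface x : P x -> relint (subface (active x)) x.
Proof.
move=> Px; have Fx : subface (active x) x by split=> // i; rewrite inE => /eqP.
split=> // h hd; have h0 i : i \in active x -> dot (y i) h = 0.
  by move=> ia; exact: dirspace_subface hd.
have /(fd_cons _ Px)[s s0 Ps] : forall i, i \in active x -> dot (y i) h <= 0.
  by move=> i /h0 ->.
exists s => //; split=> // i ia.
by rewrite dotD dotZ h0// mulr0 addr0; move: ia; rewrite inE => /eqP.
Qed.

Lemma cons_min_face x : P x -> exists2 F, faces P F & relint F x.
Proof.
move=> Px; exists (subface (active x)); last exact: relint_subface.
by apply: subface_face; exists x; case: (relint_subface Px).
Qed.

(** The point is one of [F] with the fewest active constraints: the midpoint of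
    it and any other point of [F] has no fewer, hence all constraints active at
    it are active on [F]. In particular there are finitely many faces. *)
Lemma cons_relint F : faces P F -> exists2 x, F = subface (active x) & relint F x.
Proof.
move=> /(facesE _ cons_convex)[[x0 Fx0] _ cF FP eF].
have [k] := ubnP #|active x0|; elim: k x0 Fx0 => // k IH x Fx; rewrite ltnS => xk.
have Px := FP _ Fx; have rx := relint_subface Px.
have SF : subface (active x) `<=` F.
  by apply: (relint_min cF eF) rx Fx => z [].
have [FS|/existsNP[z /not_implyP[Fz nSz]]] := pselect (F `<=` subface (active x)).
  have eFS : F = subface (active x) by apply/seteqP.
  by exists x => //; rewrite {1}eFS.
apply: (IH ((1 - 2^-1) *: x + 2^-1 *: z)); first by apply: cF => //; lra.
apply: leq_trans xk; apply: proper_card; apply/properP.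
have Pz := FP _ Fz.
have act i : i \in active ((1 - 2^-1) *: x + 2^-1 *: z) ->
    (i \in active x) && (i \in active z).
  rewrite !inE dotD !dotZ => /eqP ai; have := Px i; have := Pz i => zi xi.
  by apply/andP; split; apply/eqP; lra.
split; first by apply/fintype.subsetP => i /act /andP[].
apply: contrapT => no; apply: nSz; split=> // i ix; apply/eqP.
have [/act/andP[_]|nact] := boolP (i \in active ((1 - 2^-1) *: x + 2^-1 *: z)).
  by rewrite inE.
by case: no; exists i.
Qed.

Lemma cons_tangent_cone x : P x -> tangent_cone P x = fd P x.
Proof.
move=> Px; apply/seteqP; split=> h.
  move=> [t [v [t0 _ vh Pt]]]; apply: (closed_fd cons_closed Px (cons_locally_conical Px)).
  apply: (closed_cvg (F := \oo) _ (@closed_closure _ (fd P x)) _ _ vh).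
  by apply: nearW => k; apply: subset_closure; exists (t k).
move=> [s s0 Ps]; exists (fun k => s / k.+1%:R), (fun=> h); split.
- by move=> k; rewrite divr_gt0.
- rewrite -(mulr0 s); apply: cvgMr; exact: cvg_harmonic.
- exact: cvg_cst.
- move=> k; apply: (fd_step cons_convex Px Ps).
  by rewrite divr_ge0 ?(ltW s0)//= ler_pdivrMr// ler_peMr ?(ltW s0)// ler1n.
Qed.

(** The ray from [h] in the direction [k] leaves the tangent cone where it first
    meets the bounding hyperplane of an active constraint that increases along
    [k]. As [k] is parallel to the affine hull, this constraint cuts out a
    proper face. *)
Lemma cons_exit x h k : P x -> fd P x h -> k \in dirspace P -> ~ fd P x k ->
  exists2 t, 0 <= t & exists F, [/\ faces P F, F <> P, F x & fd F x (h + t *: k)].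
Proof.
move=> Px /(fd_cons _ Px) ah kd /(fd_cons _ Px)/existsNP[i0 /not_implyP[i0x /negP]].
rewrite -ltNge => i0k.
pose r i := - dot (y i) h / dot (y i) k.
have [i /andP[ix ik] imin] := @Order.TotalTheory.arg_minP _ _ _ i0
  (fun i => (i \in active x) && (0 < dot (y i) k)) r (introT andP (conj i0x i0k)).
have t0 : 0 <= r i by rewrite divr_ge0 ?(ltW ik)// oppr_ge0 ah.
exists (r i) => //; exists (subface [set i]).
have Fx : subface [set i] x.
  by split=> // j; rewrite inE => /eqP ->; move: ix; rewrite inE => /eqP.
split=> //.
- by apply: subface_face; exists x.
- move=> FP; have := @dirspace_subface [set i] k i (set11 i).
  by rewrite FP => /(_ kd) ki0; rewrite ki0 ltxx in ik.
have /(fd_cons _ Px)[s s0 Ps] : forall j, j \in active x -> dot (y j) (h + r i *: k) <= 0.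
  move=> j jx; rewrite dotD dotZ; have [jk|jk] := ltP 0 (dot (y j) k).
    have := imin j; rewrite jx jk => /(_ isT); rewrite {2}/r ler_pdivlMr//; lra.
  by have := ah j jx; nra.
exists s => //; split=> // j; rewrite inE => /eqP ->.
rewrite dotD dotZ dotD dotZ /r divfK ?gt_eqF// subrr mulr0 addr0.
by move: ix; rewrite inE => /eqP.
Qed.

End Constraints.

Definition polyhedron Q : Prop :=
  exists m (y : 'I_m -> E) (b : 'I_m -> R), Q = [set x | forall i, dot (y i) x <= b i].

Variable P : set E.
Hypothesis polyP : polyhedron P.

Lemma polyhedron_convex : convex P.
Proof. by have [m [y [b ->]]] := polyP; exact: cons_convex. Qed.

Lemma polyhedron_closed : closed P.
Proof. by have [m [y [b ->]]] := polyP; exact: cons_closed. Qed.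

Lemma polyhedron_locally_conical x : P x -> locally_conical P x.
Proof. by have [m [y [b ->]]] := polyP; exact: cons_locally_conical. Qed.

Lemma polyhedron_min_face x : P x -> exists2 F, faces P F & relint F x.
Proof. by have [m [y [b ->]]] := polyP; exact: cons_min_face. Qed.

Lemma polyhedron_relint F : faces P F -> exists x, relint F x.
Proof.
by have [m [y [b ->]]] := polyP => /cons_relint[x _ rx]; exists x.
Qed.

Lemma polyhedron_finite_faces :
  exists (J : finType) (f : J -> set E), forall F, faces P F -> exists j, F = f j.
Proof.
have [m [y [b ->]]] := polyP; exists {set 'I_m}, (subface y b) => F /cons_relint[x -> _].
by exists (active y b x).
Qed.

Lemma polyhedron_tangent_cone x : P x -> tangent_cone P x = fd P x.
Proof. by have [m [y [b ->]]] := polyP; exact: cons_tangent_cone. Qed.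

Lemma polyhedron_exit x h k : P x -> fd P x h -> k \in dirspace P -> ~ fd P x k ->
  exists2 t, 0 <= t & exists F, [/\ faces P F, F <> P, F x & fd F x (h + t *: k)].
Proof. by have [m [y [b ->]]] := polyP; exact: cons_exit. Qed.

End Polyhedra.

(** * Faces of tangent cones *)

Section FaceOfFace.
Context {R : realType} {n : nat}.
Local Notation E := 'rV[R]_n.
Implicit Types (a b c x y z h u v : E) (P Q F : set E) (s t : R).

Lemma faces_between P Q F : convex P -> faces P Q -> faces P F -> F `<=` Q -> faces Q F.
Proof.
move=> cP /(facesE _ cP)[_ _ cQ QP eQ] /(facesE _ cP)[F0 Fc cF FP eF] FQ.
apply/(facesE _ cQ); split=> // a b t t01 Qa Qb; apply: eF => //; exact: QP.
Qed.

Lemma faces_self P : P !=set0 -> closed P -> convex P -> faces P P.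
Proof. by move=> P0 Pc cP; apply/(facesE _ cP); split. Qed.

Lemma face_relint_min P Q F x : convex P -> faces P Q -> faces P F -> relint Q x ->
  F x -> Q `<=` F.
Proof.
move=> cP /(facesE _ cP)[_ _ _ QP _] /(facesE _ cP)[_ _ cF _ eF].
exact: relint_min cF eF _ QP.
Qed.

Lemma dirspace_fd F x : F x -> dirspace (fd F x) = dirspace F.
Proof.
move=> Fx; apply/eqP; rewrite eqEsubv; apply/andP; split.
  apply: (dirspaceP (fd F x)).2 => _ [u Fu [v Fv <-]].
  by rewrite memvB// (fd_dirspace Fx).
apply: (dirspaceP F).2 => _ [u Fu [v Fv <-]].
apply: (dirspaceP (fd F x)).1; exists (u - x); first exact: fd_mem.
by exists (v - x); [exact: fd_mem|rewrite opprB addrA subrK].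
Qed.

Lemma polyhedral_coneP Q : polyhedral_cone Q ->
  [/\ polyhedron Q, Q 0, (forall u v, Q u -> Q v -> Q (u + v)) &
      forall s u, 0 <= s -> Q u -> Q (s *: u)].
Proof.
move=> [m [y [_ ->]]]; split.
- by exists m, y, (fun=> 0).
- by move=> i; rewrite -(scale0r 0) dotZ mul0r.
- by move=> u v Qu Qv i; rewrite dotD; have := Qu i; have := Qv i; lra.
- by move=> s u s0 Qu i; rewrite dotZ mulr_ge0_le0.
Qed.

End FaceOfFace.

Section TangentFaces.
Context {R : realType} {n : nat}.
Local Notation E := 'rV[R]_n.
Implicit Types (a b c y z h u v : E) (Q F G : set E) (s t : R).
Variables (P : set E) (F0 : set E) (x : E).
Hypotheses (polyP : polyhedron P) (fF0 : faces P F0) (rx : relint F0 x).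

Let cP : convex P := polyhedron_convex polyP.
Let F0x : F0 x := rx.1.
Let F0P : F0 `<=` P. Proof. by case/(facesE _ cP): fF0. Qed.
Let Px : P x := F0P F0x.

Lemma ri_relint F y : ri F y -> relint F y.
Proof.
move=> [Fy /nbhs_ballP[e e0 Fe]]; split=> // h hd.
have /near0_ex[s s0 se] := near_scale h e0; exists s => //; apply: Fe.
  by rewrite -ball_normE/= opprD addrA subrr add0r normrN.
by rewrite addrC addKr memvZ.
Qed.

Lemma relint_ri F y : faces P F -> relint F y -> ri F y.
Proof.
move=> /(facesE _ cP)[_ _ cF FP eF] [Fy dF]; split=> //.
have /near0_ex[e e0 lF] :=
  face_locally_conical cP FP eF cF Fy (polyhedron_locally_conical polyP (FP _ Fy)).
apply/nbhs_ballP; exists e => // z; rewrite -ball_normE/= distrC => ze zd.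
by rewrite -(subrK y z) addrC; apply: lF => //; exact: dF.
Qed.

(** The tangent cones at the points of [ri F0] coincide by [fd_relint]. *)
Lemma face_tangent_coneE : face_tangent_cone P F0 = fd P x.
Proof.
apply/seteqP; split=> h.
  by move=> /(_ x (relint_ri fF0 rx)); rewrite (polyhedron_tangent_cone polyP).
move=> hx y /ri_relint ry; rewrite (polyhedron_tangent_cone polyP (F0P ry.1)).
exact: (fd_relint cP F0P ry F0x).
Qed.

Lemma convex_fd F : convex F -> F x -> convex (fd F x).
Proof.
move=> cF Fx u v t /andP[t0 t1] Fu Fv.
by apply: fdD => //; apply: fdZ => //; rewrite subr_ge0.
Qed.

Lemma cone_face F : faces P F -> F0 `<=` F -> cone (set_sub F F0) = fd F x.
Proof.
move=> /(facesE _ cP)[_ _ cF FP eF] F0F; have Fx := F0F _ F0x.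
apply/seteqP; split=> h.
  apply; split.
    split; first exact: fd0.
      exact/convexE/convex_fd.
    by move=> t u t0 Fu; exact: fdZ.
  move=> _ [u Fu [v F0v <-]].
  rewrite -(subrK x u) -addrA; apply: fdD => //; first exact: fd_mem.
  apply: (fd_sub F0F); apply: rx.2; apply: (dirspaceP F0).1.
  by exists x => //; exists v.
move=> [s s0 Fs] K [[K0 _ KZ] FK].
have /(KZ s^-1) : K (s *: h).
  by apply: FK; exists (x + s *: h) => //; exists x => //; rewrite addrC addKr.
by rewrite scalerA mulVf ?gt_eqF// scale1r; apply; rewrite invr_ge0 ltW.
Qed.

Lemma fd_face F : faces P F -> F x -> faces (fd P x) (fd F x).
Proof.
move=> /(facesE _ cP)[_ Fc cF FP eF] Fx.
apply/(facesE _ (convex_fd cP Px)); split.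
- by exists 0; exact: fd0.
- apply: closed_fd => //; apply: (face_locally_conical cP) => //.
  exact: polyhedron_locally_conical.
- exact: convex_fd.
- exact: fd_sub.
- move=> a b t t01 /(fd_near cP Px) na /(fd_near cP Px) nb Fab.
  have [s s0 [[Pa Pb] Fs]] := near0_ex (filterI (filterI na nb) (fd_near cF Fx Fab)).
  have [|Fa Fb] := eF _ _ _ t01 Pa Pb.
    by at_point Fs vec.
  by split; exists s.
Qed.

(** A face [G] of the tangent cone is itself a cone, so it is determined by the
    part of [P] in its translate by [x]; this part is the required face. It
    contains [F0] because the directions of [F0] are lineal in the tangent
    cone, and the apex, which is in [G], is the midpoint of a direction and its
    opposite. *)
Lemma face_fd G : faces (fd P x) G -> exists F, [/\ faces P F, F0 `<=` F & G = fd F x].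
Proof.
move=> /(facesE _ (convex_fd cP Px))[[g Gg] Gc cG GT eG].
have half : 0 < (2^-1 : R) < 1 by lra.
have G0 : G 0.
  have [] // := eG 0 (2%:R *: g) 2^-1 half (fd0 Px).
    by apply: fdZ => //; exact: GT.
  by at_point Gg vfield.
have GZ r u : 0 < r -> G u -> G (r *: u).
  move=> r0 Gu; have i01 : 0 < (1 + r)^-1 < 1.
    by rewrite invr_gt0 invf_lt1 ?ltrDl ?addr_gt0 ?r0.
  have [] // := eG 0 ((1 + r) *: u) _ i01 (fd0 Px).
  - by apply: fdZ => //; [lra|exact: GT].
  - by at_point Gu ltac:(vfield; rewrite gt_eqF// addr_gt0).
  move=> _ Gu1.
  rewrite (_ : r *: u = (1 - r / (1 + r)) *: 0 + (r / (1 + r)) *: ((1 + r) *: u)).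
    apply: cG => //.
    by rewrite divr_ge0 ?addr_ge0 ?(ltW r0)//= ler_pdivrMr ?addr_gt0// mul1r lerDr.
  by vfield; rewrite gt_eqF// addr_gt0.
pose F := P `&` [set z | G (z - x)].
have FE : G = fd F x.
  apply/seteqP; split=> h.
    move=> Gh; have [s s0 Ps] := GT _ Gh.
    by exists s => //; split=> //=; rewrite addrC addKr; exact: GZ.
  move=> [s s0 [_ /=]]; rewrite addrC addKr => /(GZ s^-1).
  by rewrite scalerA mulVf ?gt_eqF// scale1r invr_gt0; exact.
exists F; split=> //.
  apply/(facesE _ cP); split.
  - by exists x; split=> //=; rewrite subrr.
  - apply: closedI; first exact: polyhedron_closed.
    apply: (@preimage_closed _ _ (fun z => z - x)) => // z _.
    have idc : (id u @[u --> nbhs z] --> z) by exact: cvg_id.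
    have cstc : (cst x u @[u --> nbhs z] --> x) by exact: cvg_cst.
    exact: (cvgB idc cstc).
  - move=> u v t t01 [Pu Gu] [Pv Gv]; split; first exact: cP.
    by rewrite /= (_ : _ - x = (1 - t) *: (u - x) + t *: (v - x)); [exact: cG|vec].
  - by move=> z [].
  - move=> a b t t01 Pa Pb [_ /= Gx].
    have [] := eG (a - x) (b - x) t t01 (fd_mem _ Pa) (fd_mem _ Pb).
      by at_point Gx vec.
    by move=> Ga Gb; split.
move=> y F0y; split; first exact: F0P.
have dy : y - x \in dirspace F0 by apply: (dirspaceP F0).1; exists y => //; exists x.
have Ty : fd P x (y - x) by apply: (fd_sub F0P); exact: rx.2.
have Tny : fd P x (- (y - x)) by apply: (fd_sub F0P); apply: rx.2; rewrite memvN.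
have [] // := eG (y - x) (- (y - x)) 2^-1 half Ty Tny.
by at_point G0 vfield.
Qed.

Lemma fd_face_inj F G : faces P F -> faces P G -> F x -> G x -> fd F x `<=` fd G x ->
  F `<=` G.
Proof.
move=> /(facesE _ cP)[_ _ cF FP eF] /(facesE _ cP)[_ _ cG GP eG] Fx Gx FG y Fy.
have /(fd_near cG Gx) nG := FG _ (fd_mem x Fy).
have [s s0 [s1 Gs]] : exists2 s : R, 0 < s & s < 1 /\ G (x + s *: (y - x)).
  by apply: near0_ex; apply: filterI => //; exact: nbhs_right_lt.
have s01 : 0 < s < 1 by rewrite s0 s1.
have [] // := eG x y s s01 Px (FP _ Fy).
by at_point Gs vec.
Qed.

End TangentFaces.

(** * The face structure of a complementarity relation *)

Section ComplementarityRelation.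
Context {R : realType} {n : nat}.
Local Notation E := 'rV[R]_n.
Variables (C : set E) (Lam : set E -> set E).
Hypotheses (polyC : polyhedron C) (compl : complementarity_relation C Lam).

Let cC : convex C := polyhedron_convex polyC.

Lemma compl_cone F : faces C F -> polyhedral_cone (Lam F).
Proof. by move=> /compl[]. Qed.

(** The complementarity correspondence at [F], read on the feasible directions
    at a relative interior point. *)
Lemma compl_fd F x : faces C F -> relint F x -> exists M : set E -> set E,
  [/\ set_bij (faces (fd C x)) (faces (Lam F)) M,
      forall G, faces (fd C x) G ->
        (\dim (dirspace G) + \dim (dirspace (M G)) = n)%N &
      forall G, faces C G -> F `<=` G -> M (fd G x) = Lam G].
Proof.
move=> fF rx; have [_ [M [[_ _ Mbij Mdim _] ML]]] := compl fF.
rewrite (face_tangent_coneE polyC fF rx) in Mbij Mdim.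
exists M; split=> // G fG FG.
by rewrite -(cone_face polyC rx fG FG) ML.
Qed.

Lemma compl_dim F : faces C F -> (\dim (dirspace F) + \dim (dirspace (Lam F)))%N = n.
Proof.
move=> fF; have [x rF] := polyhedron_relint polyC fF.
have /(facesE _ cC)[_ _ _ FC _] := fF.
have [M [_ Mdim ML]] := compl_fd fF rF.
have := Mdim _ (fd_face polyC fF rF fF rF.1).
by rewrite ML// dirspace_fd//; exact: rF.1.
Qed.

Lemma compl_face F G : faces C F -> faces C G -> F `<=` G -> faces (Lam F) (Lam G).
Proof.
move=> fF fG FG; have [x rF] := polyhedron_relint polyC fF.
have /(facesE _ cC)[_ _ _ FC _] := fF.
have [M [[Mfun _ _] _ ML]] := compl_fd fF rF.
rewrite -(ML G fG FG); apply: Mfun.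
exact: (fd_face polyC fF rF fG (FG _ rF.1)).
Qed.

Lemma compl_surj F Q : faces C F -> faces (Lam F) Q ->
  exists G, [/\ faces C G, F `<=` G & Q = Lam G].
Proof.
move=> fF fQ; have [x rF] := polyhedron_relint polyC fF.
have [M [[_ _ Msurj] _ ML]] := compl_fd fF rF.
have [T fT <-] := Msurj _ fQ.
have [G [fG FG ->]] := face_fd polyC fF rF fT.
by exists G; split=> //; rewrite ML.
Qed.

Lemma compl_inj F G G' : faces C F -> faces C G -> faces C G' ->
  F `<=` G -> F `<=` G' -> Lam G = Lam G' -> G = G'.
Proof.
move=> fF fG fG' FG FG' LG; have [x rF] := polyhedron_relint polyC fF.
have /(facesE _ cC)[_ _ _ FC _] := fF; have Cx := FC _ rF.1.
have Gx := FG _ rF.1; have Gx' := FG' _ rF.1.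
have [M [[_ Minj _] _ ML]] := compl_fd fF rF.
have eqM : fd G x = fd G' x.
  by apply: Minj; rewrite ?inE ?ML//; exact: (fd_face polyC fF rF).
by apply/seteqP; split; apply: (fd_face_inj polyC fF rF) => //; rewrite eqM.
Qed.

(** Above a common subface the order is reversed in both directions: a face of
    [Lam F] that lies in [Lam G] is a face of [Lam G], hence is [Lam] of a face
    above [G], which by injectivity is [G']. *)
Lemma compl_anti F G G' : faces C F -> faces C G -> faces C G' ->
  F `<=` G -> F `<=` G' -> Lam G' `<=` Lam G -> G `<=` G'.
Proof.
move=> fF fG fG' FG FG' LG.
have [polyF _ _ _] := polyhedral_coneP (compl_cone fF).
have fGG' : faces (Lam G) (Lam G').
  by apply: (faces_between (polyhedron_convex polyF)) LG; exact: compl_face.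
have [H [fH GH LH]] := compl_surj fG fGG'.
by rewrite (compl_inj fF fG' fH FG' (subset_trans FG GH) LH).
Qed.

End ComplementarityRelation.

(** * Lifting pairs of preimages along segments *)

Section SumMap.
Context {R : realType} {n : nat}.
Local Notation E := 'rV[R]_n.
Implicit Types (X : E -> E -> Prop) (a h w z d : E) (s t : R).

(** Openness at [(a, h)] of the map [(a, h) |-> a + h] restricted to [X]. *)
Definition sum_open_at X a h : Prop :=
  forall e, 0 < e -> \forall r \near 0^'+, forall w, `|w| < r ->
    exists a' h', [/\ X a' h', `|a' - a| < e, `|h' - h| < e & a' + h' = a + h + w].

(** Injectivity of the same map near [(a, h)]; given the sum, the second
    component is determined by the first. *)
Definition locally_injective X a h : Prop :=
  \forall e \near 0^'+, forall a1 h1 a2 h2, X a1 h1 -> X a2 h2 ->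
    `|a1 - a| < e -> `|h1 - h| < e -> `|a2 - a| < e -> `|h2 - h| < e ->
    a1 + h1 = a2 + h2 -> a1 = a2.

Definition two_preimages X z : Prop :=
  exists a h a' h', [/\ X a h, X a' h', a <> a', a + h = z & a' + h' = z].

Lemma near_scale0 t0 w e : 0 < e -> \forall t \near t0, `|(t - t0) *: w| < e.
Proof.
move=> e0; have W0 : 0 < `|w| + 1 by rewrite ltr_wpDl.
apply/nbhs_ballP; exists (e / (`|w| + 1)); first by rewrite /= divr_gt0.
move=> t; rewrite /ball/= distrC ltr_pdivlMr// normrZ; apply: le_lt_trans.
by rewrite ler_wpM2l// lerDl.
Qed.

Section Lifting.
Variables (J : finType) (A B : J -> set E) (U V : J -> {vspace E}).
Hypotheses (Acl : forall j, closed (A j)) (Bcl : forall j, closed (B j)).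
Hypotheses (AU : forall j a a', A j a -> A j a' -> a - a' \in U j).
Hypotheses (BV : forall j h h', B j h -> B j h' -> h - h' \in V j).
Hypotheses (UV : forall j, (U j :&: V j)%VS = 0%VS).
Variable X : E -> E -> Prop.
Hypothesis XE : forall a h, X a h <-> exists j, A j a /\ B j h.
Hypothesis Xop : forall a h, X a h -> sum_open_at X a h.

(** Within a cell with transversal factors a point is determined by its sum,
    through the projection along [V j] onto [U j]. *)
Lemma affine_section z d j : exists p q : E, forall t a h,
  A j a -> B j h -> a + h = z + t *: d -> a = p + t *: q.
Proof.
have [[a0 [h0 [Aa0 Bh0]]]|no] := pselect (exists a h, A j a /\ B j h); last first.
  by exists 0, 0 => t a h Aa Bh; case: no; exists a, h.
pose f := daddv_pi (U j) (V j).
exists (a0 + f (z - a0 - h0)), (f d) => t a h Aa Bh ahE.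
have fU : f (a - a0) = a - a0 by apply: daddv_pi_id => //; exact: AU.
have fV : f (h - h0) = 0.
  have hV := BV Bh Bh0; have VU : (V j :&: U j)%VS = 0%VS by rewrite capvC UV.
  have := daddv_pi_add (UV j) (subvP (addvSr (U j) (V j)) _ hV).
  by rewrite (daddv_pi_id VU hV) => /eqP; rewrite -subr_eq0 addrK => /eqP.
rewrite -addrA -linearZ -linearD/=.
have -> : z - a0 - h0 + t *: d = (a - a0) + (h - h0).
  by rewrite addrAC (addrAC z) -ahE; vec.
by rewrite linearD/= fU fV addr0 addrC subrK.
Qed.

Lemma closed_affine_preimage (Q : set E) p q : closed Q -> closed [set t | Q (p + t *: q)].
Proof.
move=> Qcl; apply: (@preimage_closed R^o E (fun t => p + t *: q)) => // t _.
have c1 : (cst p u @[u --> nbhs t] --> p) by exact: cvg_cst.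
have c2 : ((u : R^o) *: q @[u --> nbhs t] --> t *: q) by exact: cvgZr_tmp.
exact: (cvgD c1 c2).
Qed.

Lemma two_preimages_open z d : open [set t : R | two_preimages X (z + t *: d)].
Proof.
rewrite openE => t [a [h [a' [h' [Xah Xah' neq ahE ahE']]]]].
have e0 : 0 < `|a - a'| / 2 by rewrite divr_gt0// normr_gt0 subr_eq0; apply/eqP.
have [r r0 [opa opb]] := near0_ex (filterI (Xop Xah e0) (Xop Xah' e0)).
have nt : \forall u \near t, `|(u - t) *: d| < r := near_scale0 t d r0.
apply: filterS nt => u ur.
have [b [k [Xbk ba _ bk]]] := opa _ ur; have [b' [k' [Xbk' ba' _ bk']]] := opb _ ur.
exists b, k, b', k'; split=> //.
- move=> bb; move: ba ba'; rewrite -bb (distrC b a) => ba ba'.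
  by have := ler_distD b a a'; lra.
- by rewrite bk ahE; vec.
- by rewrite bk' ahE'; vec.
Qed.

(** In a fixed pair of cells the two preimages move affinely along the line, so
    they have limits in the same closed cells; if the limits merge, local
    injectivity at the limit says that they were equal before. *)
Lemma two_preimages_closed z d t0 :
  (forall a h, X a h -> a + h = z + t0 *: d -> locally_injective X a h) ->
  closure [set t : R | two_preimages X (z + t *: d)] t0 ->
  two_preimages X (z + t0 *: d).
Proof.
move=> linj cl; apply: contrapT => no.
suff H : forall jk : J * J, \forall t \near t0, ~ exists a h a' h',
    [/\ A jk.1 a /\ B jk.1 h, A jk.2 a' /\ B jk.2 h', a <> a',
        a + h = z + t *: d & a' + h' = z + t *: d].
  have /cl[t [[a [h [a' [h' [/XE[j Xj] /XE[k Xk] neq e1 e2]]]]] /(_ (j, k))]] :=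
    filter_forall (nbhs_filter t0) H.
  by apply; exists a, h, a', h'.
move=> [j k] /=.
have [p [q pqE]] := affine_section z d j; have [p' [q' pqE']] := affine_section z d k.
have cell i (p1 q1 : E) : ~ (A i (p1 + t0 *: q1) /\ B i (z - p1 + t0 *: (d - q1))) ->
    \forall t \near t0, ~ (A i (p1 + t *: q1) /\ B i (z - p1 + t *: (d - q1))).
  have op : open (~` [set t | A i (p1 + t *: q1) /\ B i (z - p1 + t *: (d - q1))]).
    apply: closed_openC; apply: (@closedI _ [set t | A i (p1 + t *: q1)]).
      exact: closed_affine_preimage.
    exact: closed_affine_preimage.
  by move: op; rewrite openE => op /op.
have hE (p1 q1 : E) t a h : a = p1 + t *: q1 -> a + h = z + t *: d ->
    h = z - p1 + t *: (d - q1).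
  move=> aE ahE; apply: (addrI a); rewrite ahE aE; vec.
have [tj|/cell] := pselect (A j (p + t0 *: q) /\ B j (z - p + t0 *: (d - q))); last first.
  apply: filterS => t nt [a [h [a' [h' [[Aa Bh] _ _ e1 _]]]]].
  by apply: nt; rewrite -(pqE t a h)// -(hE p q t a h)//; exact: (pqE t a h).
have [tk|/cell] := pselect (A k (p' + t0 *: q') /\ B k (z - p' + t0 *: (d - q'))); last first.
  apply: filterS => t nt [a [h [a' [h' [_ [Aa Bh] _ _ e1]]]]].
  by apply: nt; rewrite -(pqE' t a' h')// -(hE p' q' t a' h')//; exact: (pqE' t a' h').
have pp : p + t0 *: q = p' + t0 *: q'.
  apply: contrapT => neq; apply: no.
  exists (p + t0 *: q), (z - p + t0 *: (d - q)), (p' + t0 *: q'), (z - p' + t0 *: (d - q')).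
  by split=> //; [apply/XE; exists j|apply/XE; exists k|vec|vec].
have hh : z - p + t0 *: (d - q) = z - p' + t0 *: (d - q').
  by apply: (addrI (p + t0 *: q)); rewrite {2}pp; vec.
have Xj : X (p + t0 *: q) (z - p + t0 *: (d - q)) by apply/XE; exists j.
have sumE : p + t0 *: q + (z - p + t0 *: (d - q)) = z + t0 *: d by vec.
have [e e0 inj] := near0_ex (linj _ _ Xj sumE).
have small w : \forall t \near t0, `|(t - t0) *: w| < e := near_scale0 t0 w e0.
near=> t; move=> [a [h [a' [h' [[Aa Bh] [Aa' Bh'] neq e1 e2]]]]]; apply: neq.
have aE := pqE t a h Aa Bh e1; have aE' := pqE' t a' h' Aa' Bh' e2.
apply: (inj a h a' h').
- by apply/XE; exists j.
- by apply/XE; exists k.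
- have -> : a - (p + t0 *: q) = (t - t0) *: q by rewrite aE; vec.
  by near: t; exact: small.
- rewrite (hE p q t a h aE e1).
  have -> : z - p + t *: (d - q) - (z - p + t0 *: (d - q)) = (t - t0) *: (d - q) by vec.
  by near: t; exact: small.
- have -> : a' - (p + t0 *: q) = (t - t0) *: q' by rewrite pp aE'; vec.
  by near: t; exact: small.
- rewrite hh (hE p' q' t a' h' aE' e2).
  have -> : z - p' + t *: (d - q') - (z - p' + t0 *: (d - q')) = (t - t0) *: (d - q').
    by vec.
  by near: t; exact: small.
- by rewrite e1 e2.
Unshelve. all: by end_near.
Qed.

(** The parameters over which there are two preimages form an open and closed
    part of [[0, 1]]. *)
Lemma lift_two_preimages z d :
  (forall t a h, 0 <= t <= 1 -> X a h -> a + h = z + t *: d -> locally_injective X a h) ->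
  two_preimages X z -> two_preimages X (z + d).
Proof.
move=> linj z2.
pose T := [set t : R | two_preimages X (z + t *: d)].
pose I := `[0%R, 1%R]%classic : set R.
suff : I `&` T = I.
  move=> IT; have : (I `&` T) 1 by rewrite IT/I/= in_itv/= ler01 lexx.
  by rewrite /T => -[_ /=]; rewrite scale1r.
apply: (@segment_connected R 0 1).
- by exists 0; split; rewrite /I/T/= ?in_itv/= ?lexx ?ler01// scale0r addr0.
- by exists T => //; exact: two_preimages_open.
- exists (closure T); first exact: closed_closure.
  apply/seteqP; split=> t [It Tt]; split=> //; first exact: subset_closure.
  apply: two_preimages_closed Tt => a h Xah ahE; apply: linj Xah ahE.
  by move: It; rewrite /I/= in_itv.
Qed.

End Lifting.
End SumMap.

(** * Injectivity of the sum map on the graph *)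

Section Cells.
Context {R : realType} {n : nat}.
Local Notation E := 'rV[R]_n.
Implicit Types (x v a h w z d y k : E) (s t : R) (F Q : set E).
Variables (C : set E) (Lam : set E -> set E).
Hypotheses (polyC : polyhedron C) (compl : complementarity_relation C Lam).

Let cC : convex C := polyhedron_convex polyC.

Lemma face_convex F : faces C F -> convex F.
Proof. by case/(facesE _ cC). Qed.

Lemma face_closed F : faces C F -> closed F.
Proof. by case/(facesE _ cC). Qed.

Lemma face_sub F : faces C F -> F `<=` C.
Proof. by case/(facesE _ cC). Qed.

Lemma face_extreme F : faces C F -> extreme C F.
Proof. by case/(facesE _ cC). Qed.

Lemma face_conical F x : faces C F -> F x -> locally_conical F x.
Proof.
move=> fF Fx; apply: (face_locally_conical cC) => //.
- exact: face_sub.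
- exact: face_extreme.
- exact: face_convex.
- by apply: (polyhedron_locally_conical polyC); exact: (face_sub fF).
Qed.

Lemma lam_poly F : faces C F -> polyhedron (Lam F).
Proof. by move=> fF; have [] := polyhedral_coneP (compl_cone compl fF). Qed.

Lemma lam0 F : faces C F -> Lam F 0.
Proof. by move=> fF; have [] := polyhedral_coneP (compl_cone compl fF). Qed.

Lemma lam_convex F : faces C F -> convex (Lam F).
Proof. by move=> /lam_poly/polyhedron_convex. Qed.

(** A pair [(x, v)] stands for the point [(x, x + v)] of the graph of the
    complementarity mapping; see [mapping_graph]. In these coordinates the graph
    is the union of the products of a face and its cone. *)
Definition cell F x v : Prop := [/\ faces C F, F x & Lam F v].

Definition graph x v : Prop := exists F, cell F x v.

(** The graph near [(x, v)] is a translate of this cone; see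
    [graph_cone_near]. *)
Definition graph_cone x v a h : Prop :=
  exists F, [/\ cell F x v, fd F x a & fd (Lam F) v h].

Definition cone_injective x v : Prop := forall a h a' h',
  graph_cone x v a h -> graph_cone x v a' h' -> a + h = a' + h' -> a = a'.

Variables (J : finType) (face : J -> set E).
Hypothesis faceP : forall F, faces C F -> exists j, F = face j.

Lemma closed_near0 (Q : set E) x : closed Q -> ~ Q x ->
  \forall e \near (0 : R)^'+, forall a, `|a| < e -> ~ Q (x + a).
Proof.
move=> /closed_openC; rewrite openE => op /op /nbhs_ballP[e0 /= e00 ball0].
near=> e => a ae; apply: ball0; rewrite -ball_normE/= opprD addrA subrr add0r normrN.
apply: (lt_le_trans ae); near: e; exact: nbhs_right_le.
Unshelve. all: by end_near.
Qed.

(** The cells are closed and finite in number. *)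
Lemma cells_near x v : \forall e \near (0 : R)^'+, forall F a h,
  `|a| < e -> `|h| < e -> cell F (x + a) (v + h) -> cell F x v.
Proof.
suff H : \forall e \near (0 : R)^'+, forall j, forall a h,
    `|a| < e -> `|h| < e -> cell (face j) (x + a) (v + h) -> cell (face j) x v.
  apply: filterS H => e H F a h ae he cF; have [fF _ _] := cF.
  by have [j Fj] := faceP fF; rewrite Fj in cF *; exact: H ae he cF.
apply: filter_forall => j.
have [fj|nfj] := pselect (faces C (face j)); last by near=> e => a h _ _ [].
have [Fx|/(closed_near0 (face_closed fj))] := pselect (face j x); last first.
  by apply: filterS => e ne a h ae _ [_ /ne]; have := ae.
have [Lv|/(closed_near0 (polyhedron_closed (lam_poly fj)))] :=
  pselect (Lam (face j) v); last first.
  by apply: filterS => e ne a h _ he [_ _ /ne]; have := he.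
by near=> e.
Unshelve. all: by end_near.
Qed.

Lemma graph_cone_near x v : \forall e \near (0 : R)^'+, forall a h,
  `|a| < e -> `|h| < e -> graph (x + a) (v + h) <-> graph_cone x v a h.
Proof.
have H : \forall e \near (0 : R)^'+, forall j, forall a h, `|a| < e -> `|h| < e ->
    cell (face j) x v -> fd (face j) x a -> fd (Lam (face j)) v h ->
    graph (x + a) (v + h).
  apply: filter_forall => j.
  have [[fj Fx Lv]|nc] := pselect (cell (face j) x v); last by near=> e.
  apply: filterS (filterI (face_conical fj Fx) (polyhedron_locally_conical (lam_poly fj) Lv)).
  by move=> e [c1 c2] a h ae he _ fa fh; exists (face j); split; auto.
apply: filterS (filterI H (cells_near x v)) => e [{}H ce] a h ae he; split.
  move=> [F cF]; exists F; split; first exact: ce cF.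
    by case: cF => _ Fa _; exists 1 => //; rewrite scale1r.
  by case: cF => _ _ Fh; exists 1 => //; rewrite scale1r.
move=> [F [cF fa fh]]; have [fF _ _] := cF; have [j Fj] := faceP fF.
by rewrite Fj in cF fa fh; exact: (H j).
Unshelve. all: by end_near.
Qed.

Lemma graph_coneZ x v a h s : 0 <= s -> graph_cone x v a h ->
  graph_cone x v (s *: a) (s *: h).
Proof.
by move=> s0 [F [[fF Fx Lv] fa fh]]; exists F; split=> //; exact: fdZ.
Qed.

Lemma graph_coneZE x v a h s : 0 < s -> graph_cone x v (s *: a) (s *: h) ->
  graph_cone x v a h.
Proof.
move=> s0 [F [[fF Fx Lv] fa fh]]; exists F; split=> //; first exact: (fdZE Fx s0).
exact: (fdZE Lv s0).
Qed.

Lemma graph_cone_graph x v a h : graph_cone x v a h ->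
  \forall s \near 0^'+, graph (x + s *: a) (v + s *: h).
Proof.
move=> gc; have /near0_ex[e e0 ge] := graph_cone_near x v.
near=> s; have s0 : 0 < s by near: s; exact: nbhs_right_gt.
have sa : `|s *: a| < e by near: s; exact: near_scale.
have sh : `|s *: h| < e by near: s; exact: near_scale.
by apply/(ge _ _ sa sh); apply: graph_coneZ => //; exact: ltW.
Unshelve. all: by end_near.
Qed.

(** By homogeneity, the cone near [(a, h)] looks like the graph near the point
    reached by a small step along [(a, h)]. *)
Lemma graph_cone_locally_injective x v a h :
  (\forall s \near 0^'+, cone_injective (x + s *: a) (v + s *: h)) ->
  locally_injective (graph_cone x v) a h.
Proof.
move=> ninj; have /near0_ex[e0 e00 ge] := graph_cone_near x v.
have [s s0 [inj [sa sh]]] := near0_ex (filterI ninj (filterI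
  (near_scale_lt (`|a| + 1) e00) (near_scale_lt (`|h| + 1) e00))).
have /near0_ex[e1 e10 ge1] := graph_cone_near (x + s *: a) (v + s *: h).
near=> e.
have e_1 : e < 1 by near: e; exact: nbhs_right_lt.
have e_s : s * e < e1.
  by rewrite mulrC; near: e; exact: near_scale_lt.
have norm_le b c : `|b - c| < e -> s * (`|c| + 1) < e0 ->
    `|s *: b| < e0 /\ `|s *: (b - c)| < e1.
  move=> bc se; rewrite !normrZ gtr0_norm//; split.
    apply: le_lt_trans se; rewrite ler_wpM2l ?(ltW s0)//.
    by have := ler_normD (b - c) c; rewrite subrK; lra.
  by apply: lt_trans e_s; rewrite ltr_pM2l.
have transfer b k : graph_cone x v b k -> `|b - a| < e -> `|k - h| < e ->
    graph_cone (x + s *: a) (v + s *: h) (s *: (b - a)) (s *: (k - h)).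
  move=> gbk /norm_le[//|sb1 sb2] /norm_le[//|sk1 sk2].
  apply/ge1 => //; have /(ge _ _ sb1 sk1) := graph_coneZ (ltW s0) gbk.
  by congr graph; vec.
move=> a1 h1 a2 h2 g1 g2 a1e h1e a2e h2e sumE.
have := inj _ _ _ _ (transfer _ _ g1 a1e h1e) (transfer _ _ g2 a2e h2e).
have -> : s *: (a1 - a) + s *: (h1 - h) = s *: (a2 - a) + s *: (h2 - h).
  by rewrite -!scalerDr addrACA sumE; congr (_ *: _); vec.
move=> /(_ erefl) /(scalerI (lt0r_neq0 s0)); exact: addIr.
Unshelve. all: by end_near.
Qed.

Lemma graph_locally_injective x v : cone_injective x v -> locally_injective graph x v.
Proof.
move=> inj; apply: filterS (graph_cone_near x v) => e ge.
move=> a1 h1 a2 h2 g1 g2 a1e h1e a2e h2e sumE.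
have tr b k : graph b k -> `|b - x| < e -> `|k - v| < e -> graph_cone x v (b - x) (k - v).
  by move=> gbk be ke; apply/ge => //; rewrite ![_ + (_ - _)]addrC !subrK.
have := inj _ _ _ _ (tr _ _ g1 a1e h1e) (tr _ _ g2 a2e h2e).
rewrite addrACA sumE addrACA => /(_ erefl); exact: addIr.
Qed.

Hypothesis graph_open : forall x v, graph x v -> sum_open_at graph x v.

Lemma graph_cone_open x v a h : graph_cone x v a h -> sum_open_at (graph_cone x v) a h.
Proof.
move=> gc e e0; have /near0_ex[e1 e10 ge] := graph_cone_near x v.
have [s s0 [gs [sa sh]]] := near0_ex (filterI (graph_cone_graph gc) (filterI
  (near_scale_lt (`|a| + e) e10) (near_scale_lt (`|h| + e) e10))).
have se0 : 0 < s * e by rewrite mulr_gt0.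
have [r r0 op] := near0_ex (graph_open gs se0).
near=> r'.
have r's : s * r' < r by rewrite mulrC; near: r'; exact: near_scale_lt.
move=> w wr'.
have [|x' [v' [gx' x'e v'e sumE]]] := op (s *: w).
  by rewrite normrZ gtr0_norm//; apply: lt_trans r's; rewrite ltr_pM2l.
have bound (c c' u : E) : `|c' - (c + s *: u)| < s * e -> s * (`|u| + e) < e1 ->
    `|c' - c| < e1 /\ `|s^-1 *: (c' - c) - u| < e.
  move=> ce se1; split.
    have -> : c' - c = (c' - (c + s *: u)) + s *: u by vec.
    apply: lt_trans se1; apply: le_lt_trans (ler_normD _ _) _.
    by rewrite normrZ gtr0_norm//; lra.
  rewrite -(ltr_pM2l s0) -{1}(gtr0_norm s0) -normrZ scalerBr scalerA mulfV ?gt_eqF// scale1r.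
  by rewrite -addrA -opprD.
have [x'1 x'2] := bound _ _ _ x'e sa; have [v'1 v'2] := bound _ _ _ v'e sh.
exists (s^-1 *: (x' - x)), (s^-1 *: (v' - v)); split=> //.
  apply: (graph_coneZE s0); rewrite !scalerA mulfV ?gt_eqF// !scale1r.
  by apply/ge => //; rewrite ![_ + (_ - _)]addrC !subrK.
rewrite -scalerDr addrACA sumE.
have -> : x + s *: a + (v + s *: h) + s *: w + (- x - v) = s *: (a + h + w) by vec.
by rewrite scalerA mulVf ?gt_eqF// scale1r.
Unshelve. all: by end_near.
Qed.

Lemma cell_unique F E1 x v : faces C F -> relint F x -> relint (Lam F) v ->
  cell E1 x v -> E1 = F.
Proof.
move=> fF rx rv [fE Ex Lv].
have FE : F `<=` E1 by exact: (face_relint_min cC fF fE rx).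
apply/seteqP; split=> //.
apply: (compl_anti polyC compl fF) => //.
have fL : faces (Lam F) (Lam E1) by exact: (compl_face polyC compl).
apply: (face_relint_min (lam_convex fF) _ fL rv Lv).
apply: faces_self; [by exists 0; exact: lam0| |exact: lam_convex].
by apply: polyhedron_closed; exact: lam_poly.
Qed.

(** At a relative interior point of a cell the graph is that cell alone, so by
    openness the sums of its directions fill a neighbourhood of the origin. As
    the dimensions add up to [n], the sum is then direct. *)
Lemma dirspaces_full F : faces C F -> (dirspace F + dirspace (Lam F))%VS = fullv.
Proof.
move=> fF; have [x rx] := polyhedron_relint polyC fF.
have fLF : faces (Lam F) (Lam F).
  apply: faces_self; [by exists 0; exact: lam0| |exact: lam_convex].
  by apply: polyhedron_closed; exact: lam_poly.
have [v rv] := polyhedron_relint (lam_poly fF) fLF.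
have gxv : graph x v by exists F; split=> //; [exact: rx.1|exact: rv.1].
apply/eqP; rewrite eqEsubv subvf/=; apply/subvP => w _.
have /near0_ex[e e0 ce] := cells_near x v.
have [r r0 op] := near0_ex (graph_open gxv e0).
have /near0_ex[s s0 sw] := near_scale w r0.
have [x' [v' [[E1 cE] xe ve sumE]]] := op _ sw.
have EF : E1 = F.
  apply: (cell_unique fF rx rv); apply: (ce _ _ _ xe ve).
  by rewrite ![_ + (_ - _)]addrC !subrK.
rewrite {}EF in cE; have [_ Fx' Lv'] := cE.
have : s *: w \in (dirspace F + dirspace (Lam F))%VS.
  have -> : s *: w = (x' - x) + (v' - v) by rewrite addrACA sumE; vec.
  apply: memv_add.
    by apply: (dirspaceP F).1; exists x' => //; exists x => //; exact: rx.1.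
  by apply: (dirspaceP (Lam F)).1; exists v' => //; exists v => //; exact: rv.1.
by move=> /(memvZ s^-1); rewrite scalerA mulVf ?gt_eqF// scale1r.
Qed.

Lemma dirspaces_cap F : faces C F -> (dirspace F :&: dirspace (Lam F))%VS = 0%VS.
Proof.
move=> fF; have := dimv_sum_cap (dirspace F) (dirspace (Lam F)).
rewrite dirspaces_full// (compl_dim polyC compl fF) dimvf.
have -> : dim (E : vectType R) = n by rewrite /dim/= mul1n.
move=> /eqP; rewrite -[X in _ == X]addn0 eqn_add2l dimv_eq0 => /eqP //.
Qed.

Lemma dirspaces_cap0 F u : faces C F -> u \in dirspace F -> u \in dirspace (Lam F) -> u = 0.
Proof.
move=> fF uF uL; have : u \in (dirspace F :&: dirspace (Lam F))%VS by rewrite memv_cap uF.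
by rewrite dirspaces_cap// memv0 => /eqP.
Qed.


(** A face through the midpoint of a segment contains that segment. *)
Lemma fd_pm P F x y : extreme P F -> convex P -> P x -> F x ->
  fd P x y -> fd P x (- y) -> fd F x y.
Proof.
move=> eF cP Px Fx /(fd_near cP Px) ny /(fd_near cP Px) nny.
have [s s0 [Py Pny]] := near0_ex (filterI ny nny).
have half : 0 < (2^-1 : R) < 1 by lra.
have [|Fy _] := eF _ _ _ half Py Pny; last by exists s.
by at_point Fx vfield.
Qed.

(** In this section [F] is the smallest face at [x0] and [Lam F'] the smallest
    face of [Lam F] at [v0], so that the cells at [(x0, v0)] are those of the
    faces between [F] and [F'], and their directions lie in [K] times [H]. *)
Section Local.
Variables (x0 v0 : E) (F F' : set E).
Hypotheses (fF : faces C F) (fF' : faces C F') (FF' : F `<=` F').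
Hypotheses (rF : relint F x0) (rF' : relint (Lam F') v0).

Let Fx0 : F x0 := rF.1.
Let fLF' : faces (Lam F) (Lam F'). Proof. exact: (compl_face polyC compl). Qed.
Let Lv0 : Lam F v0.
Proof. by case/(facesE _ (lam_convex fF)): fLF' => _ _ _ + _; apply; exact: rF'.1. Qed.

Lemma cell_between G : cell G x0 v0 <-> [/\ faces C G, F `<=` G & G `<=` F'].
Proof.
split=> [[fG Gx Lv]|[fG FG GF']].
  have FG : F `<=` G by exact: (face_relint_min cC fF fG rF).
  split=> //; apply: (compl_anti polyC compl fF) => //.
  apply: (face_relint_min (lam_convex fF) fLF' _ rF' Lv).
  exact: (compl_face polyC compl).
split=> //; first exact: FG.
have : faces (Lam G) (Lam F') by exact: (compl_face polyC compl).
by case/(facesE _ (lam_convex fG)) => _ _ _ + _; apply; exact: rF'.1.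
Qed.

Let cellF : cell F x0 v0. Proof. by apply/cell_between; split. Qed.
Let cellF' : cell F' x0 v0. Proof. by apply/cell_between; split. Qed.

Let K := fd F' x0.
Let H := fd (Lam F) v0.

Let cellK G : cell G x0 v0 -> fd G x0 `<=` K.
Proof. by move=> /cell_between[_ _ GF']; exact: fd_sub. Qed.

Let cellH G : cell G x0 v0 -> fd (Lam G) v0 `<=` H.
Proof.
move=> /cell_between[fG FG _]; apply: fd_sub.
by have /(facesE _ (lam_convex fF))[] := compl_face polyC compl fF fG FG.
Qed.

Let KD a b : K a -> K b -> K (a + b).
Proof. by apply: fdD; [exact: face_convex|exact: FF']. Qed.

Let HD a b : H a -> H b -> H (a + b).
Proof. by apply: fdD => //; exact: lam_convex. Qed.

Let cellD G a b : cell G x0 v0 -> fd G x0 a -> fd G x0 b -> fd G x0 (a + b).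
Proof. by move=> [fG Gx _]; apply: fdD => //; exact: face_convex. Qed.

Let lamD G a b : cell G x0 v0 -> fd (Lam G) v0 a -> fd (Lam G) v0 b -> fd (Lam G) v0 (a + b).
Proof. by move=> [fG _ Lv]; apply: fdD => //; exact: lam_convex. Qed.

Let linF G a : cell G x0 v0 -> a \in dirspace F -> fd G x0 a.
Proof.
move=> /cell_between[_ FG _] aF; apply: (fd_sub FG); exact: rF.2.
Qed.

Let linL G h : cell G x0 v0 -> h \in dirspace (Lam F') -> fd (Lam G) v0 h.
Proof.
move=> /cell_between[fG FG GF'] hF; apply: (fd_sub (P := Lam F')); last exact: rF'.2.
by have /(facesE _ (lam_convex fG))[] := compl_face polyC compl fG fF' GF'.
Qed.

Let K_pm y : K y -> K (- y) -> y \in dirspace F.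
Proof.
move=> Ky Kny; apply: (fd_dirspace Fx0); apply: fd_pm Ky Kny => //.
- by have /(facesE _ (face_convex fF'))[] := faces_between cC fF' fF FF'.
- exact: face_convex.
- exact: FF'.
Qed.

Let H_pm y : H y -> H (- y) -> y \in dirspace (Lam F').
Proof.
move=> Hy Hny; have Lv' := rF'.1; apply: (fd_dirspace Lv'); apply: fd_pm Hy Hny => //.
  by have /(facesE _ (lam_convex fF))[] := fLF'.
exact: lam_convex.
Qed.

Let K_dir y : K y -> y \in dirspace F'. Proof. by apply: fd_dirspace; exact: FF'. Qed.

Let H_dir y : H y -> y \in dirspace (Lam F). Proof. exact: fd_dirspace. Qed.

(** With no cell strictly between, everything follows from [K] and [H] having
    no common direction [y]. By openness [- y] is a sum of directions of one of
    the two cells, and transversality then puts [- y] in [H] or in [K], so that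
    [y] is lineal in one of them; transversality again gives [y = 0]. *)
Lemma cone_injective_two_cells : (forall G, cell G x0 v0 -> G = F \/ G = F') ->
  cone_injective x0 v0.
Proof.
move=> two.
have KH y : K y -> H y -> y = 0.
  move=> Ky Hy.
  have g0 : graph_cone x0 v0 0 0 by exists F; split=> //; exact: fd0.
  have /near0_ex[r r0 op] := graph_cone_open g0 (@ltr01 R).
  have /near0_ex[s s0 sy] := near_scale (- y) r0.
  have [b [g [gbg _ _ sumE]]] := op _ sy.
  have {gbg} : graph_cone x0 v0 (s^-1 *: b) (s^-1 *: g).
    by apply: graph_coneZ => //; rewrite invr_ge0 ltW.
  have : s^-1 *: b + s^-1 *: g = - y.
    by rewrite -scalerDr sumE !add0r scalerA mulVf ?gt_eqF// scale1r.
  move: (s^-1 *: b) (s^-1 *: g) => {sumE}b {}g sumE [G [/[dup] cG /two[->|->] fb fg]].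
    have gy : g + y = 0.
      apply: (dirspaces_cap0 fF).
        have -> : g + y = - b.
          by apply/eqP; rewrite -subr_eq0 opprK addrAC (addrC g) sumE addNr.
        by rewrite memvN (fd_dirspace Fx0).
      by rewrite memvD ?H_dir.
    have yM : y \in dirspace (Lam F').
      by apply: H_pm => //; move/eqP: gy; rewrite addr_eq0 => /eqP <-.
    exact: (dirspaces_cap0 fF' (K_dir Ky)).
  have by0 : b + y = 0.
    apply: (dirspaces_cap0 fF'); first by rewrite memvD ?K_dir.
    have -> : b + y = - g by apply/eqP; rewrite -subr_eq0 opprK addrAC sumE addNr.
    by rewrite memvN (fd_dirspace rF'.1).
  have yL : y \in dirspace F.
    by apply: K_pm => //; move/eqP: by0; rewrite addr_eq0 => /eqP <-.
  exact: (dirspaces_cap0 fF yL (H_dir Hy)).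
have cross a h a' h' : fd F x0 a -> H h -> K a' -> fd (Lam F') v0 h' ->
    a + h = a' + h' -> a = a'.
  move=> Fa Hh Ka' Lh' sumE; have y_eq : a' - a = h - h'.
    by apply/eqP; rewrite subr_eq addrAC (addrC h) sumE addrK.
  apply/esym/eqP; rewrite -subr_eq0; apply/eqP; apply: KH.
    by apply: KD => //; apply: linF => //; rewrite memvN (fd_dirspace Fx0).
  rewrite y_eq; apply: HD => //; apply: (linL cellF).
  by rewrite memvN (fd_dirspace rF'.1).
have same G a h a' h' : cell G x0 v0 -> fd G x0 a -> fd (Lam G) v0 h ->
    fd G x0 a' -> fd (Lam G) v0 h' -> a + h = a' + h' -> a = a'.
  move=> [fG Gx Lv] Ga Lh Ga' Lh' sumE; apply/eqP; rewrite -subr_eq0; apply/eqP.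
  have y_eq : a - a' = h' - h.
    by apply/eqP; rewrite subr_eq addrAC (addrC h') -sumE addrK.
  apply: (dirspaces_cap0 fG); first by rewrite memvB ?(fd_dirspace Gx).
  by rewrite y_eq memvB ?(fd_dirspace Lv).
move=> a h a' h' [G [cG Ga Lh]] [G' [cG' Ga' Lh']] sumE.
have [e|e] := two _ cG; have [e'|e'] := two _ cG';
  rewrite e in cG Ga Lh; rewrite e' in cG' Ga' Lh'.
- exact: (same F _ h _ h').
- exact: (cross _ h _ h').
- by apply/esym; apply: (cross _ h' _ h).
- exact: (same F' _ h _ h').
Qed.

Definition ncells x v : nat := #|[pred j | `[< cell (face j) x v >]]|.

Hypothesis IH : forall x v, graph x v -> (ncells x v < ncells x0 v0)%N -> cone_injective x v.

(** Moving from the base point out of some cell leaves strictly fewer cells. *)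
Lemma cone_injective_along a h G : graph_cone x0 v0 a h -> cell G x0 v0 ->
  ~ (fd G x0 a /\ fd (Lam G) v0 h) ->
  \forall s \near 0^'+, cone_injective (x0 + s *: a) (v0 + s *: h).
Proof.
move=> gah cG nG; have /near0_ex[e e0 ce] := cells_near x0 v0; have ng := graph_cone_graph gah.
near=> s; have s0 : 0 < s by near: s; exact: nbhs_right_gt.
have sa : `|s *: a| < e by near: s; exact: near_scale.
have sh : `|s *: h| < e by near: s; exact: near_scale.
apply: IH; first by near: s.
have [fG _ _] := cG; have [j Gj] := faceP fG.
apply: proper_card; apply/properP; split.
  apply/fintype.subsetP => i; rewrite -!topredE/= => /asboolP ci; apply/asboolP.
  exact: (ce _ _ _ sa sh ci).
exists j; rewrite -topredE/=; first by apply/asboolP; rewrite -Gj.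
by apply/asboolP; rewrite -Gj => -[_ Ga Lh]; apply: nG; split; exists s.
Unshelve. all: by end_near.
Qed.

(** If a preimage [(a, h)] of a point of [H] leaves the lineality of [H], then
    the segment [h + [0, 1] a] stays in [H], so that near [(0, h)] the points
    [(s a, h)] and [(0, h + s a)] of the graph have the same image. *)
Lemma preimage_in_H a h : graph_cone x0 v0 a h -> H (a + h) ->
  ~ fd (Lam F') v0 h -> a = 0.
Proof.
move=> [G [cG Ga Lh]] Hah nh; have [fG Gx Lv] := cG.
have g0h : graph_cone x0 v0 0 h by exists G; split=> //; exact: fd0.
have n1 := cone_injective_along g0h cellF' (fun q => nh q.2).
have n2 := fd_near (lam_convex fG) Lv Lh.
have n3 := fd_near (lam_convex fF) Lv0 (cellH cG Lh).
have n4 := fd_near (lam_convex fF) Lv0 Hah.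
have [s s0 [inj [Ls [L1 L2]]]] := near0_ex (filterI n1 (filterI n2 (filterI n3 n4))).
rewrite scaler0 addr0 in inj.
apply: (inj a 0 0 a); last by rewrite addrC.
  by exists G; split=> //; exact: fd0.
exists F; split; [by []|exact: fd0|exists s => //].
by at_point L2 vec.
Qed.

(** The same with the roles of the two factors exchanged. *)
Lemma preimage_in_K a h : graph_cone x0 v0 a h -> K (a + h) ->
  ~ fd F x0 a -> h = 0.
Proof.
move=> [G [cG Ga Lh]] Kah na; have [fG Gx Lv] := cG; have [_ F'x _] := cellF'.
have ga0 : graph_cone x0 v0 a 0 by exists G; split=> //; exact: fd0.
have n1 := cone_injective_along ga0 cellF (fun q => na q.1).
have n2 := fd_near (face_convex fG) Gx Ga.
have n3 := fd_near (face_convex fF') F'x (cellK cG Ga).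
have n4 := fd_near (face_convex fF') F'x Kah.
have [s s0 [inj [Gs [K1 K2]]]] := near0_ex (filterI n1 (filterI n2 (filterI n3 n4))).
rewrite scaler0 addr0 in inj.
apply/esym; apply: (inj 0 h h 0); last by rewrite addrC.
  by exists G; split=> //; exact: fd0.
exists F'; split; [by split=> //; exact: rF'.1|exists s => //|exact: (fd0 rF'.1)].
by at_point K2 vec.
Qed.

Variable G : set E.
Hypotheses (cG : cell G x0 v0) (GF : G <> F) (GF' : G <> F').

Lemma fd_in_cell Q : cell Q x0 v0 -> Q <> F -> exists2 a, fd Q x0 a & a \notin dirspace F.
Proof.
move=> cQ QF; apply: contrapT => no; apply: QF.
have [fQ FQ QF'] := (cell_between Q).1 cQ.
apply/seteqP; split=> //; apply: (fd_face_inj polyC fF rF) => //; first exact: FQ.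
move=> a Qa; apply: rF.2; apply: contrapT => /negP na; apply: no.
by exists a.
Qed.

Lemma fd_in_lam Q : cell Q x0 v0 -> Q <> F' ->
  exists2 h, fd (Lam Q) v0 h & ~ fd (Lam F') v0 h.
Proof.
move=> cQ QF; apply: contrapT => no; apply: QF.
have [fQ FQ QF'] := (cell_between Q).1 cQ.
apply/seteqP; split=> //; apply: (compl_anti polyC compl fF) => //.
have [_ _ LQ] := cQ.
apply: (fd_face_inj (lam_poly fF) fLF' rF') => //.
- exact: (compl_face polyC compl).
- exact: rF'.1.
- by move=> h Lh; apply: contrapT => nh; apply: no; exists h.
Qed.

(** A nonzero common direction of [K] and [H] belongs to no proper face of
    either: adding to it a direction of the other factor of the cell gives a
    point covered by [preimage_in_H] or [preimage_in_K]. But adding to [y] a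
    multiple of a direction [k] of [G], chosen parallel to [H], leads to a
    proper face of [H] without leaving [K]. *)
Lemma KH_trivial y : K y -> H y -> y = 0.
Proof.
have inK Q z : cell Q x0 v0 -> Q <> F' -> fd Q x0 z -> H z -> z = 0.
  move=> cQ QF Qz Hz; have [h Lh nh] := fd_in_lam cQ QF.
  apply: (@preimage_in_H z h) => //; first by exists Q.
  by apply: HD => //; exact: (cellH cQ).
have inH Q z : cell Q x0 v0 -> Q <> F -> fd (Lam Q) v0 z -> K z -> z = 0.
  move=> cQ QF Qz Kz; have [a Qa na] := fd_in_cell cQ QF.
  apply: (@preimage_in_K a z); first by exists Q.
    by apply: KD => //; exact: (cellK cQ).
  by move=> /(fd_dirspace Fx0); apply/negP.
move=> Ky Hy.
have [k0 Gk0 nk0] := fd_in_cell cG GF.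
(* Subtracting a lineal direction makes the direction parallel to [Lam F]. *)
have : k0 \in (dirspace F + dirspace (Lam F))%VS by rewrite dirspaces_full// memvf.
move=> /memv_addP[l lF [k kL k0E]].
have Gk : fd G x0 k.
  have -> : k = k0 - l by rewrite k0E addrC addKr.
  by apply: cellD => //; apply: linF => //; rewrite memvN.
have nk : k \notin dirspace F.
  by apply: contra nk0 => kF; rewrite k0E memvD.
have nHk : ~ H k.
  by move=> Hk; move: nk; rewrite (inK G k)// mem0v.
have [t t0 [Q [fQ QF Qv Qyk]]] := polyhedron_exit (lam_poly fF) Lv0 Hy kL nHk.
have [E1 [fE1 FE1 QE]] := compl_surj polyC compl fF fQ.
have cE1 : cell E1 x0 v0 by split=> //; [exact: FE1|rewrite -QE].
have E1F : E1 <> F by move=> e; apply: QF; rewrite QE e.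
have Kk : K k by exact: (cellK cG).
have Kyk : K (y + t *: k) by apply: KD => //; apply: fdZ => //; exact: FF'.
have yk0 : y + t *: k = 0 by apply: (inH E1) => //; rewrite -QE.
have [tz|tn] := eqVneq t 0; first by move: yk0; rewrite tz scale0r addr0.
have tp : 0 < t by rewrite lt_neqAle eq_sym tn.
have Knk : K (- k).
  apply: (fdZE (FF' Fx0) tp); rewrite scalerN.
  by move/eqP: yk0; rewrite addr_eq0 => /eqP <-.
by move: nk; rewrite (K_pm Kk Knk).
Qed.

(** Points of [K], and their translates along the lineality space of [H], have
    only the obvious preimage. *)
Lemma preimage_unique a h k l : graph_cone x0 v0 a h -> K k ->
  l \in dirspace (Lam F') -> a + h = k + l -> a = k.
Proof.
move=> gah Kk lM sumE.
have sumE' : a + (h - l) = k by rewrite addrA sumE addrK.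
have gahl : graph_cone x0 v0 a (h - l).
  have [Q [cQ Qa Lh]] := gah; exists Q; split=> //.
  by apply: lamD => //; apply: linL => //; rewrite memvN.
have [Fa|nFa] := pselect (fd F x0 a); last first.
  have hl0 : h - l = 0 by apply: (preimage_in_K gahl) => //; rewrite sumE'.
  by rewrite -sumE' hl0 addr0.
apply/eqP; rewrite eq_sym -subr_eq0; apply/eqP; apply: KH_trivial.
  by apply: KD => //; apply: linF => //; rewrite memvN (fd_dirspace Fx0).
have -> : k - a = h - l by rewrite -sumE' addrC addKr.
by have [Q [cQ _ Lh]] := gahl; exact: (cellH cQ).
Qed.


Let W := (dirspace F + dirspace (Lam F'))%VS.

Let K_W k : K k -> k \in W -> k \in dirspace F.
Proof.
move=> Kk /memv_addP[l lF [m mL kE]].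
suff m0 : m = 0 by rewrite kE m0 addr0.
apply: (dirspaces_cap0 fF') => //.
have -> : m = k - l by rewrite kE addrC addKr.
by rewrite memvB ?K_dir//; apply: linF.
Qed.

(** Away from the lineality space the graph has fewer cells, so the induction
    hypothesis provides the local injectivity that lifting needs. *)
Lemma graph_cone_lift z d :
  (forall t, 0 <= t <= 1 -> z + t *: d \notin W) ->
  two_preimages (graph_cone x0 v0) z -> two_preimages (graph_cone x0 v0) (z + d).
Proof.
move=> nW.
pose I := {j : J | `[< cell (face j) x0 v0 >]}.
have cI (i : I) : cell (face (val i)) x0 v0 by case: i => j /= /asboolP.
have fI (i : I) : faces C (face (val i)) by case: (cI i).
apply: (@lift_two_preimages _ _ I (fun i => fd (face (val i)) x0)
  (fun i => fd (Lam (face (val i))) v0) (fun i => dirspace (face (val i)))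
  (fun i => dirspace (Lam (face (val i))))).
- move=> i; have [_ fx _] := cI i; apply: closed_fd => //.
    by apply: face_closed.
  exact: face_conical.
- move=> i; have [_ _ Lv] := cI i; apply: closed_fd => //.
    by apply: polyhedron_closed; exact: lam_poly.
  by apply: polyhedron_locally_conical => //; exact: lam_poly.
- by move=> i a a' fa fa'; have [_ fx _] := cI i; rewrite memvB ?(fd_dirspace fx).
- by move=> i a a' fa fa'; have [_ _ Lv] := cI i; rewrite memvB ?(fd_dirspace Lv).
- by move=> i; exact: dirspaces_cap.
- move=> a h; split; last by move=> [i [fa fh]]; exists (face (val i)).
  move=> [Q [cQ Qa Qh]]; have [fQ _ _] := cQ; have [j Qj] := faceP fQ.
  have jI : `[< cell (face j) x0 v0 >] by apply/asboolP; rewrite -Qj.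
  by exists (exist _ j jI); rewrite /= -Qj.
- by move=> a h gah; exact: graph_cone_open.
move=> t a h t01 gah ahE; apply: graph_cone_locally_injective.
have /negP naW := nW t t01.
have [Fa|nFa] := pselect (fd F x0 a); last first.
  by apply: (cone_injective_along gah cellF) => -[].
have [Lh|nLh] := pselect (fd (Lam F') v0 h); last first.
  by apply: (cone_injective_along gah cellF') => -[].
case: naW; rewrite -ahE memv_add ?(fd_dirspace Fx0)//.
exact: (fd_dirspace rF'.1).
Qed.

(** Two preimages of [z] would persist along any segment that avoids the image
    [W] of the lineality space, whereas a point of [K] has only one. Hence the
    segments from [z] to all [k] in [K] off the lineality space meet [W], that
    is, [z] is in [- r k + W] for some positive [r]. Then all these [k] agree up
    to positive multiples modulo the lineality space of [K], although [G]
    contains some of them and misses others. *)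
Lemma cone_injective_between : cone_injective x0 v0.
Proof.
move=> a1 h1 a2 h2 g1 g2 sumE; apply: contrapT => neq.
set z := a1 + h1 in sumE.
have z2 : two_preimages (graph_cone x0 v0) z by exists a1, h1, a2, h2.
have zW : z \notin W.
  apply/negP => /memv_addP[l lF [m mL zE]]; apply: neq.
  have Kl : K l by apply: linF.
  rewrite (preimage_unique g1 Kl mL zE).
  by rewrite (preimage_unique g2 Kl mL) // -sumE.
have hit k : K k -> k \notin dirspace F -> exists2 r, 0 < r & z + r *: k \in W.
  move=> Kk nk; have kW : k \notin W by apply: contra nk; exact: K_W.
  have [t t01 tW] : exists2 t : R, 0 <= t <= 1 & z + t *: (k - z) \in W.
    apply: contrapT => no; have nW t : 0 <= t <= 1 -> z + t *: (k - z) \notin W.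
      by move=> t01; apply/negP => tW; apply: no; exists t.
    have [a [h [a' [h' [ga ga' neq' e e']]]]] := graph_cone_lift nW z2.
    have ek : z + (k - z) = k + 0 by rewrite addrC subrK addr0.
    apply: neq'; rewrite (preimage_unique ga Kk (mem0v _)) ?e//.
    by rewrite (preimage_unique ga' Kk (mem0v _)) ?e'.
  have t0 : t != 0 by apply: contra zW => /eqP t0; move: tW; rewrite t0 scale0r addr0.
  have t1 : t != 1.
    by apply: contra kW => /eqP t1; move: tW; rewrite t1 scale1r addrC subrK.
  have tp : 0 < t by rewrite lt_neqAle eq_sym t0; case/andP: t01.
  have tm : 0 < 1 - t by rewrite subr_gt0 lt_neqAle t1; case/andP: t01.
  exists (t / (1 - t)); first exact: divr_gt0.
  have -> : z + (t / (1 - t)) *: k = (1 - t)^-1 *: (z + t *: (k - z)).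
    by vfield; rewrite gt_eqF.
  exact: memvZ.
have [k1 Gk1 nk1] := fd_in_cell cG GF.
have [fG FG GF'sub] := (cell_between G).1 cG.
have [k2 Kk2 nk2] : exists2 k, K k & ~ fd G x0 k.
  apply: contrapT => no; apply: GF'; apply/seteqP; split=> //.
  apply: (fd_face_inj polyC fF rF) => //; [exact: FF'|exact: FG|].
  by move=> k Kk; apply: contrapT => nk; apply: no; exists k.
have nFk2 : k2 \notin dirspace F by apply/negP => /(linF cG).
have [r1 r10 W1] := hit k1 (cellK cG Gk1) nk1.
have [r2 r20 W2] := hit k2 Kk2 nFk2.
have [_ Gx _] := cG.
apply: nk2; apply: (fdZE Gx r20).
have -> : r2 *: k2 = r1 *: k1 + (r2 *: k2 - r1 *: k1) by vec.
apply: cellD => //; first by apply: fdZ => //; exact: ltW.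
apply: linF => //.
have : r2 *: k2 - r1 *: k1 \in W.
  by rewrite (_ : _ - _ = (z + r2 *: k2) - (z + r1 *: k1)); [exact: memvB|vec].
move=> /memv_addP[l lF [m mL E12]].
suff m0 : m = 0 by rewrite E12 m0 addr0.
apply: (dirspaces_cap0 fF') => //.
have -> : m = r2 *: k2 - r1 *: k1 - l by rewrite E12 addrC addKr.
rewrite !memvB ?memvZ ?K_dir//; last exact: linF.
exact: (cellK cG).
Qed.

End Local.

(** Induction on the number of cells at the point. *)
Lemma graph_cone_injective x v : graph x v -> cone_injective x v.
Proof.
have [k] := ubnP (ncells x v); elim: k x v => // k IHk x v; rewrite ltnS => xk gxv.
have [F1 [fF1 F1x L1v]] := gxv.
have [F fF rF] := polyhedron_min_face polyC (face_sub fF1 F1x).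
have FF1 : F `<=` F1 by exact: (face_relint_min cC fF fF1 rF).
have Lv : Lam F v.
  by have /(facesE _ (lam_convex fF))[_ _ _ + _] := compl_face polyC compl fF fF1 FF1; apply.
have [Q fQ rQ] := polyhedron_min_face (lam_poly fF) Lv.
have [F' [fF' FF' QE]] := compl_surj polyC compl fF fQ; rewrite {}QE in rQ fQ.
have [two|/existsNP[G /not_implyP[cG /not_orP[GF GF']]]] :=
  pselect (forall G, cell G x v -> G = F \/ G = F').
  exact: (cone_injective_two_cells fF fF' FF' rF rQ).
apply: (cone_injective_between fF fF' FF' rF rQ _ cG GF GF') => x' v' g' lt'.
by apply: IHk => //; exact: leq_trans xk.
Qed.

(** The segment from [x] to [x + v] stays in [C], so near [(x, 0)] both
    [(x, s v)] and [(x + s v, 0)] are in the graph, with the same sum. *)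
Lemma graph_over_C x v : graph x v -> C (x + v) -> v = 0.
Proof.
move=> [F [fF Fx Lv]] Cxv.
have Cx := face_sub fF Fx.
have fC : faces C C.
  by apply: faces_self => //; [exists x|exact: polyhedron_closed].
have gx0 : graph x 0 by exists F; split=> //; exact: lam0.
apply/esym; apply: (graph_cone_injective gx0 (a := 0) (h := v) (a' := v) (h' := 0)).
- exists F; split; [by split=> //; exact: lam0|exact: fd0|].
  by exists 1 => //; rewrite scale1r add0r.
- exists C; split; [by split=> //; exact: lam0|by exists 1 => //; rewrite scale1r|].
  by apply: fd0; exact: lam0.
- by rewrite addrC.
Qed.

(** Two preimages could be carried along the segment that leads to the point
    [x] of [C], where the preimage is unique. *)
Lemma graph_injective x v x' v' : graph x v -> graph x' v' -> x + v = x' + v' -> x = x'.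
Proof.
move=> gx gx' sumE; apply: contrapT => neq.
have [F [fF Fx _]] := gx; have Cx := face_sub fF Fx.
pose I := {j : J | `[< faces C (face j) >]}.
have fI (i : I) : faces C (face (val i)) by case: i => j /= /asboolP.
have : two_preimages graph (x + v) by exists x, v, x', v'.
move=> /(@lift_two_preimages _ _ I (fun i => face (val i))
  (fun i => Lam (face (val i))) (fun i => dirspace (face (val i)))
  (fun i => dirspace (Lam (face (val i)))) _ _ _ _ _ graph _ graph_open _ (- v)).
case.
- by move=> i; apply: face_closed.
- by move=> i; apply: polyhedron_closed; exact: lam_poly.
- by move=> i a a' fa fa'; apply: (dirspaceP _).1; exists a => //; exists a'.
- by move=> i a a' fa fa'; apply: (dirspaceP _).1; exists a => //; exists a'.
- by move=> i; exact: dirspaces_cap.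
- move=> a h; split; last by move=> [i [fa fh]]; exists (face (val i)).
  move=> [Q [fQ Qa Qh]]; have [j Qj] := faceP fQ.
  have jI : `[< faces C (face j) >] by apply/asboolP; rewrite -Qj.
  by exists (exist _ j jI); rewrite /= -Qj.
- move=> t a h _ gah _; apply: graph_locally_injective; exact: graph_cone_injective.
move=> a [h [a' [h' [ga ga' neq' e e']]]]; apply: neq'.
have xvE : x + v - v = x by rewrite addrK.
have h0 : h = 0 by apply: graph_over_C ga _; rewrite e xvE.
have h'0 : h' = 0 by apply: graph_over_C ga' _; rewrite e' xvE.
by move: e e'; rewrite h0 h'0 !addr0 => -> ->.
Qed.

End Cells.

(** * Regularity and the main theorem *)

Section Regularity.
Context {R : realType} {n : nat}.
Local Notation E := 'rV[R]_n.
Implicit Types (x v z u w : E) (F : set E).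

Lemma norm_le_enorm x : `|x| <= enorm x.
Proof.
rewrite [leLHS]mx_normrE; apply: bigmax_le; first exact: sqrtr_ge0.
move=> [i j] _ /=; rewrite (ord1 i) -sqrtr_sqr ler_sqrt; last first.
  by apply: sumr_ge0 => k _; exact: sqr_ge0.
rewrite /dot (bigD1 j)//= expr2 lerDl.
by apply: sumr_ge0 => k _; exact: sqr_ge0.
Qed.

Lemma enorm_le_norm x : enorm x <= n.+1%:R * `|x|.
Proof.
have c0 : 0 <= n.+1%:R * `|x| by rewrite mulr_ge0.
rewrite -(ger0_norm c0) -sqrtr_sqr ler_sqrt ?sqr_ge0//.
apply: (le_trans (ler_norm _)); apply: (le_trans (dot_bound _ _)).
have : \sum_i `|x 0 i| <= n%:R * `|x|.
  apply: (le_trans (ler_sum _ (fun i _ => le_coord x i))).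
  by rewrite sumr_const card_ord mulr_natl.
have : 0 <= n%:R :> R by [].
have := normr_ge0 x; rewrite -natr1; nra.
Qed.

Lemma enormB x u : enorm (x - u) = enorm (u - x).
Proof.
by congr (Num.sqrt _); apply: eq_bigr => i _; rewrite !mxE; ring.
Qed.

Variables (C : set E) (Lam : set E -> set E).
Hypotheses (polyC : polyhedron C) (compl : complementarity_relation C Lam).

Let cC : convex C := polyhedron_convex polyC.

Lemma min_faceE F x : faces C F -> relint F x -> min_face C x = F.
Proof.
move=> fF rx; apply/seteqP; split=> y.
  by apply; split=> // _ ->; exact: rx.1.
move=> Fy Q [fQ xQ]; apply: (face_relint_min cC fF fQ rx) => //.
exact: xQ.
Qed.

Lemma mapping_graph x z :
  complementarity_mapping C Lam x z <-> graph C Lam x (z - x).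
Proof.
rewrite /complementarity_mapping; split.
  case: ifP => // /set_mem Cx [v Lv <-].
  have [F fF rx] := polyhedron_min_face polyC Cx.
  exists F; split=> //; first exact: rx.1.
  by rewrite addrC addKr -(min_faceE fF rx).
move=> [G [fG Gx Lv]]; have /(facesE _ cC)[_ _ _ GC _] := fG.
have Cx := GC _ Gx; rewrite mem_set//.
have [F fF rx] := polyhedron_min_face polyC Cx.
exists (z - x); last by rewrite addrC subrK.
rewrite (min_faceE fF rx).
have FG : F `<=` G by exact: (face_relint_min cC fF fG rx).
by have /(facesE _ (lam_convex compl fF))[_ _ _ + _] := compl_face polyC compl fF fG FG; apply.
Qed.

Let Phi := complementarity_mapping C Lam.

(** Regularity moves the point of [C] by at most a multiple of the displacement
    of its image; the second component of the graph point follows. *)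
Lemma regular_graph_open : globally_regular Phi ->
  forall x v, graph C Lam x v -> sum_open_at (graph C Lam) x v.
Proof.
move=> [kappa k0 reg] x v gxv e e0; pose c := kappa * n.+1%:R.
have c0 : 0 < c by rewrite mulr_gt0.
have e2 : 0 < e / 2 by rewrite divr_gt0.
near=> r => w wr.
have rc : c * r < e / 2.
  by rewrite mulrC; near: r; exact: near_scale_lt.
have re : r < e / 2 by near: r; exact: nbhs_right_lt.
have Pz : Phi x (x + v) by apply/mapping_graph; rewrite addrC addKr.
have : (dist x (inverse_mapping Phi (x + v + w)) < (e / 2)%:E)%E.
  apply: (le_lt_trans (reg _ _)).
  apply: (@le_lt_trans _ _ (kappa%:E * (enorm w)%:E)%E); last first.
    rewrite -EFinM lte_fin; apply: le_lt_trans rc; rewrite /c -mulrA ler_pM2l//.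
    by apply: (le_trans (enorm_le_norm _)); rewrite ler_pM2l// ltW.
  apply: lee_wpmul2l; first by rewrite lee_fin ltW.
  apply: ereal_inf_lbound; exists (x + v) => //.
  by rewrite (addrC (x + v)) addrK.
move=> /ereal_inf_lt[_ [x' Px' <-]]; rewrite lte_fin => xx'.
have {}xx' : `|x' - x| < e / 2 by rewrite distrC; exact: le_lt_trans (norm_le_enorm _) xx'.
exists x', (x + v + w - x'); split.
- exact/mapping_graph.
- by apply: lt_trans xx' _; lra.
- have -> : x + v + w - x' - v = w - (x' - x) by vec.
  by apply: (le_lt_trans (ler_normB _ _)); lra.
- by rewrite addrC subrK.
Unshelve. all: by end_near.
Qed.

End Regularity.

Theorem theorem6p1 (R : realType) (n : nat) (C : set 'rV[R]_n)
    (LamC : set 'rV[R]_n -> set 'rV[R]_n) :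
  polyhedral_set C ->
  complementarity_relation C LamC ->
  globally_regular (complementarity_mapping C LamC) ->
  single_valued_lipschitz
    (inverse_mapping (complementarity_mapping C LamC)) /\
  globally_strongly_regular (complementarity_mapping C LamC).
Proof.
move=> [[c Cc] [m [y [b [_ CE]]]]] compl regular.
have polyC : polyhedron C by exists m, y, b.
have [J [face faceP]] := polyhedron_finite_faces polyC.
set Phi := complementarity_mapping C LamC in regular *.
have inj x u z : Phi x z -> Phi u z -> x = u.
  move=> /(mapping_graph polyC compl) gx /(mapping_graph polyC compl) gu.
  apply: (graph_injective polyC compl faceP (regular_graph_open polyC compl regular) gx gu).
  by rewrite !(addrC _ (z - _)) !subrK.
split; last first.
  split=> // x u /eqP xu; apply/seteqP; split=> // z [Pxz Puz].
  by apply: xu; exact: inj Pxz Puz.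
have [kappa k0 reg] := regular.
have Phic : Phi c c.
  apply/(mapping_graph polyC compl); rewrite subrr.
  have cC := polyhedron_convex polyC.
  have fC : faces C C by apply: faces_self => //; [exists c|exact: polyhedron_closed].
  by exists C; split=> //; exact: (lam0 compl).
have sol z : exists x, Phi x z.
  have : (dist c (inverse_mapping Phi z) < +oo)%E.
    apply: (le_lt_trans (reg _ _)).
    apply: (@le_lt_trans _ _ (kappa%:E * (enorm (z - c))%:E)%E); last exact: ltry.
    apply: lee_wpmul2l; first by rewrite lee_fin ltW.
    by apply: ereal_inf_lbound; exists c.
  by move=> /ereal_inf_lt[_ [x Px _] _]; exists x.
have [g gP] := choice sol.
have gE z : inverse_mapping Phi z = [set g z].
  by apply/seteqP; split=> [x Px|_ ->]; [exact: inj Px (gP z)|exact: gP].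
exists g; split=> //; exists kappa; first exact: ltW.
move=> z u; have := reg (g z) u; rewrite gE /dist image_set1 ereal_inf1 => le1.
rewrite -lee_fin EFinM; apply: (le_trans le1); apply: lee_wpmul2l.
  by rewrite lee_fin ltW.
apply: ereal_inf_lbound; exists z; first exact: gP.
by rewrite enormB.
Qed.
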